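(* Let $T>0$, $\mathbb{T}=[0,T]$, $H\in(0,1)$, and let $K^H$ be the infinite matrix with elements $$K_{ij}^H=\int_{\mathbb{T}^2}\hat P(i,t)\,\hat P(j,\tau)\,k_H(t,\tau)\,dt\,d\tau=\int_{\mathbb{T}}\hat P(i,t)\biggl[\int_0^t k_H(t,\tau)\hat P(j,\tau)\,d\tau\biggr]dt,\qquad i,j=0,1,2,\dots,$$ where $\hat P(i,\cdot)$ are the normalized Legendre polynomials on $[0,T]$ and $k_H$ is the kernel of the integral representation of fractional Brownian motion with Hurst index $H$ (both defined in the context). Then for every $j=0,1,2,\dots$ the $j$th column $K^H_{*j}$ of $K^H$ is $$K_{*j}^H=a_H\,\Gamma(3/2-H)\sqrt{\frac{2j+1}{T}}\sum_{k=0}^{j}\frac{l_{jk}\,(3/2-H)^{\overline{k}}}{T^k\,(H+1/2+k)\,k!}\,F^{H+1/2+k},$$ where $F^{\alpha}=(F^\alpha_i)_{i\ge 0}$ is the infinite column of Legendre coefficients of the power function $t^\alpha$ (defined in the context). Moreover, for $H\neq 1/2$ and all $i,j=0,1,2,\dots$, $$K_{ij}^H=a_H\,\Gamma(1/2-H)\sqrt{\frac{2j+1}{T}}\;F_i^{H+1/2}\sum_{k=0}^{j}(-1)^{j-k}\,\frac{1/2-H+k}{H+1/2+k}\,\Pi_k^{(ij)},$$ where $\Pi_0^{(ij)}=1$ and, for $k=1,2,\dots$, $$\Pi_k^{(ij)}=\frac{(H+1/2+k)^2\,(k-1/2-H)}{k^3}\cdot\frac{j-k+1}{H+1/2-i+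k}\cdot\frac{j+k}{H+1/2+i+k+1}\;\Pi_{k-1}^{(ij)}.$$
   Context: Notation. $\Gamma$ is the Gamma function; ${}_2F_1$ is the Gauss hypergeometric function (analytically continued, so that it is defined for all real arguments less than $1$); $x^{\overline{k}}=x(x+1)\cdots(x+k-1)$ is the upper (rising) factorial and $x^{\underline{k}}=x(x-1)\cdots(x-k+1)$ the lower (falling) factorial, with $x^{\overline 0}=x^{\underline 0}=1$. Normalized Legendre polynomials on $[0,T]$ (an orthonormal basis of $L_2([0,T])$): $$\hat P(i,t)=\sqrt{\frac{2i+1}{T}}\sum_{k=0}^{i}l_{ik}\frac{t^k}{T^k},\qquad l_{ik}=(-1)^{i-k}\binom{i+k}{i}\binom{i}{i-k}=(-1)^{i-k}\prod_{m=1}^{k}\frac{(i-m+1)(i+m)}{m^2},\qquad i=0,1,2,\dots$$ Constant: $a_H=\sqrt{\dfrac{2H\,\Gamma(H+1/2)\,\Gamma(3/2-H)}{\Gamma(2-2H)}}$ (so $a_{1/2}=1$). Kernel: for $0<\tau<t$, $$k_H(t,\tau)=\frac{a_H}{\Gamma(H+1/2)}\,(t-\tau)^{H-1/2}\;{}_2F_1\Bigl(\tfrac12-H,\,H-\tfrac12,\,H+\tfrac12,\,1-\tfrac{t}{\tau}\Bigr),$$ and $k_H(t,\tau)=0$ for $t\le\tau$. For $H=1/2$ this is $k_{1/2}(t,\tau)=1$ if $\tau<t$ and $0$ otherwise. It is the kernel of the representation $B_H(t)=\int_0^t k_H(t,\tau)\,dB(\tau)$ of fractional Brownian motion, and $k_H\in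 L_2([0,T]^2)$. The operator $\mathcal K_H\varphi(t)=\int_0^t k_H(t,\tau)\varphi(\tau)\,d\tau$ on $L_2([0,T])$ is the composition $$\mathcal K_H\varphi=\begin{cases}a_H\,\mathcal J^{2H}\bigl[t^{1/2-H}\,\mathcal J^{1/2-H}[t^{H-1/2}\varphi]\bigr],&H<1/2,\\ \mathcal J^1\varphi,&H=1/2,\\ a_H\,\mathcal J^{1}\bigl[t^{H-1/2}\,\mathcal J^{H-1/2}[t^{1/2-H}\varphi]\bigr],&H>1/2,\end{cases}$$ where $\mathcal J^\beta\varphi(t)=\frac1{\Gamma(\beta)}\int_0^t(t-\tau)^{\beta-1}\varphi(\tau)\,d\tau$, $\beta>0$, is the left-sided Riemann–Liouville fractional integral (a known fact which the paper takes from the literature). Legendre coefficients of power functions: for $\alpha>-1/2$ and $i=0,1,2,\dots$, $$F_i^\alpha=\int_0^T t^\alpha\,\hat P(i,t)\,dt=\sqrt{\frac{2i+1}{T}}\sum_{k=0}^i l_{ik}\frac{T^{\alpha+1}}{\alpha+k+1}=T^\alpha\sqrt T\;\frac{\sqrt{2i+1}\;\alpha^{\underline{i}}}{(\alpha+1)^{\overline{i+1}}}.$$ *)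

(* Defs.v *)
From HB Require Import structures.
From mathcomp Require Import all_boot all_order all_algebra.
From mathcomp Require Import all_classical all_reals all_analysis.
Set Implicit Arguments.
Unset Strict Implicit.
Unset Printing Implicit Defensive.
Import Order.TTheory GRing.Theory Num.Theory.
Import numFieldNormedType.Exports.

Local Open Scope classical_set_scope.
Local Open Scope ring_scope.

Section SpecialFunctions.
Context {R : realType}.
Implicit Types (a b c x : R) (f : R -> R) (n : nat).

Definition rising x n : R := \prod_(m < n) (x + m%:R).

Definition euler_gamma x : R :=
  \int[lebesgue_measure]_(t in `]0, +oo[) (t `^ (x - 1) * expR (- t)).

(* The shift [n] is the least one with [0 < x + n]; the value at the poles
   0, -1, -2, ... is 0, the denominator being 0 there. *)
Definition Gamma x : R :=
  let n := if 0 < x then 0%N else (Num.truncn (- x)).+1 in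
  euler_gamma (x + n%:R) / rising x n.

Definition analytic_at f x : Prop :=
  exists2 r : R, 0 < r & exists u : R ^nat,
    forall y, `|y - x| < r -> pseries u (y - x) @ \oo --> f y.

Definition hyp2F1_coef a b c n : R :=
  rising a n * rising b n / (rising c n * n`!%:R).

(* Analytic continuation to ]-oo, 1[ of the Gauss series, which converges on
   ]-1, 1[. Such a continuation is unique on ]-oo, 1[; the choice made by
   [xget] is only visible outside of this interval. *)
Definition hyp2F1 a b c : R -> R :=
  xget (fun=> 0) [set f |
    (forall x, `|x| < 1 -> pseries (hyp2F1_coef a b c) x @ \oo --> f x) /\
    (forall x, x < 1 -> analytic_at f x)].

End SpecialFunctions.

Section LegendreFBM.
Context {R : realType}.
Implicit Types (T H alpha t tau : R) (i j k : nat).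

Definition legendre_coef i k : R :=
  (-1) ^+ (i - k) * 'C(i + k, i)%:R * 'C(i, i - k)%:R.

Definition legendre T i t : R :=
  Num.sqrt ((2 * i%:R + 1) / T) *
  \sum_(k < i.+1) legendre_coef i k * (t ^+ k / T ^+ k).

Definition legendre_pow T alpha i : R :=
  \int[lebesgue_measure]_(t in `[0, T]) (t `^ alpha * legendre T i t).

Definition fbm_const H : R :=
  Num.sqrt (2 * H * Gamma (H + 1 / 2) * Gamma (3 / 2 - H) / Gamma (2 - 2 * H)).

(* The hypergeometric formula needs [0 < tau]; on [0, T] * [0, T] the value 0
   given for [tau <= 0] only concerns the negligible set [tau = 0]. *)
Definition fbm_kernel H t tau : R :=
  if 0 < tau < t then
    fbm_const H / Gamma (H + 1 / 2) * (t - tau) `^ (H - 1 / 2) *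
    hyp2F1 (1 / 2 - H) (H - 1 / 2) (H + 1 / 2) (1 - t / tau)
  else 0.

Definition fbm_integrand T H i j (z : R * R) : R :=
  legendre T i z.1 * legendre T j z.2 * fbm_kernel H z.1 z.2.

Definition fbm_matrix T H i j : R :=
  \int[(lebesgue_measure \x lebesgue_measure)%E]_(z in `[0, T] `*` `[0, T])
    fbm_integrand T H i j z.

Fixpoint fbm_Pi H i j k : R :=
  if k is k'.+1 then
    (H + 1 / 2 + k%:R) ^+ 2 * (k%:R - 1 / 2 - H) / k%:R ^+ 3 *
    ((j%:R - k%:R + 1) / (H + 1 / 2 - i%:R + k%:R)) *
    ((j%:R + k%:R) / (H + 1 / 2 + i%:R + k%:R + 1)) * fbm_Pi H i j k'
  else 1.

End LegendreFBM.

(* Main.v *)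
Require Import Defs.
From HB Require Import structures.
From mathcomp Require Import all_boot all_order all_algebra.
From mathcomp Require Import all_classical all_reals all_analysis.
From mathcomp Require Import measurable_realfun zify ring lra.
Set Implicit Arguments.
Unset Strict Implicit.
Unset Printing Implicit Defensive.
Import Order.TTheory GRing.Theory Num.Theory.
Import numFieldNormedType.Exports.
Local Open Scope classical_set_scope.
Local Open Scope ring_scope.

(** With [h = H - 1/2], the function [2F1 (-h) h (h+1) z] equals
    [(1-z)^h + h z \int_0^1 x^h (1-zx)^(h-1) dx] for all [z < 1]: expanding
    [(1-zx)^(h-1)] by the binomial series around any [z0 < 1] shows that the right
    side is analytic and has the Gauss series at [0], and analytic continuation
    along a half-line is unique. The substitution [v = s + x(t-s)] then gives, for
    [0 < s < t],
    [(t-s)^h 2F1(1 - t/s) = s^(-h) (t^h (t-s)^h - h \int_s^t (v-s)^h v^(h-1) dv)].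
    By Tonelli both terms have explicit moments [\int_0^t s^k ds], multiples of the
    Beta integral [B(k-h+1, h+1)], which yields the first formula. The second one
    follows from the two-term recurrence in [alpha] of the Legendre coefficients of
    [t^alpha]. *)

(** With [h = H - 1/2], the natural representation of the hypergeometric factor is Euler's: h times
    the integral of x^(h-1) (1-zx)^h over ]0, 1[. That integral diverges at 0 when h <= 0, that is,
    for H <= 1/2. The closed form used here is what one integration by parts makes of it: the weight
    becomes x^h, integrable for every h > -1, so that one argument covers H below, at and above 1/2.
    It also splits the kernel into two nonnegative pieces, the sign of h entering only in their
    combination. Tonelli therefore applies to each piece before any integrability is known, and the
    explicit moments then prove integrability. In the second formula the denominators H+1/2-i+k can
    vanish only if H+1/2 is an integer, and Gamma(1/2-H) has its pole at H = 1/2; both point to the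
    same excluded value. *)

(** * Affine change of variables on the line *)

Section Affine.
Context {R : realType}.
Local Notation mu := (@lebesgue_measure R).
Local Open Scope ereal_scope.

Lemma preimage_affine_oc (a b x y : R) : (0 < a)%R ->
  (fun t => a * t + b)%R @^-1` `]x, y] = `](x - b) / a, (y - b) / a]%classic%R.
Proof.
move=> a0; apply/seteqP; split => t /=; rewrite !in_itv/= => /andP[h1 h2];
 apply/andP; split.
- by rewrite ltr_pdivrMr// ltrBlDr mulrC.
- by rewrite ler_pdivlMr// lerBrDr mulrC.
- by move: h1; rewrite ltr_pdivrMr// ltrBlDr mulrC.
- by move: h2; rewrite ler_pdivlMr// lerBrDr mulrC.
Qed.

(** The image of [mu] under x -> a x + b, multiplied by [a], gives every half-open interval its
    length, so it is Lebesgue measure by uniqueness. Nonnegative extended-real functions are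
    allowed, so the rule is available before finiteness is known. *)
Lemma ge0_integral_affine (a b : R) (f : R -> \bar R) : (0 < a)%R ->
  measurable_fun setT f -> (forall x, 0 <= f x) ->
  \int[mu]_x f x = a%:E * \int[mu]_x f (a * x + b)%R.
Proof.
move=> a0 mf f0.
pose phi (x : measurableTypeR R) : measurableTypeR R := (a * x + b)%R.
have mphi : measurable_fun setT phi.
  apply: (measurable_funD (f := fun x => (a * x)%R) (g := cst b)) => //.
  by apply: (measurable_funM (f := cst a) (g := id)).
pose r : {nonneg R} := NngNum (ltW a0).
pose m := mscale r (pushforward mu phi).
transitivity (\int[m mphi]_x f x).
  apply: eq_measure_integral => A mA _; apply: lebesgue_measure_unique => //.
  move=> _ [[x y]] _ <-; rewrite /m /= /mscale /pushforward.
  rewrite [X in _ = _ * X](_ : _ = mu (`](x - b) / a, (y - b) / a]%classic%R)); last first.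
    by congr (mu _); exact: preimage_affine_oc.
  rewrite !lebesgue_measure_itv/= !lte_fin ltr_pM2r ?invr_gt0// ltrD2r.
  case: ifPn => xy; last by rewrite mule0.
  by rewrite -!EFinB -EFinM; congr EFin; field; rewrite gt_eqF.
rewrite ge0_integral_mscale//; congr (_ * _).
by rewrite ge0_integral_pushforward.
Qed.
End Affine.

(** * Integrals of real powers *)

Section PowRIntegral.
Context {R : realType}.
Local Notation mu := (@lebesgue_measure R).

Lemma continuous_at_powR (p x : R) : 0 < x -> {for x, continuous (@powR R ^~ p)}.
Proof.
move=> x0; apply/differentiable_continuous/derivable1_diffP.
by apply: derivable_powR; rewrite in_itv/= x0.
Qed.

Lemma integral_powR_cc (a b p : R) : 0 < a -> a < b -> p + 1 != 0 ->
  (\int[mu]_(x in `[a, b]) (x `^ p)%:E =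
   ((b `^ (p + 1) - a `^ (p + 1)) / (p + 1))%:E)%E.
Proof.
move=> a0 ab p1.
have dF (x : R) : 0 < x ->
    is_derive x 1 (fun x => (p + 1)^-1 *: (x `^ (p + 1))) (x `^ p).
  move=> x0; have := is_derive1_powR (p + 1) x0 => H.
  apply: is_derive_eq; rewrite addrK.
  by rewrite /GRing.scale/= mulKf.
rewrite (continuous_FTC2 (F := fun x => (p + 1)^-1 *: (x `^ (p + 1))) ab).
- by rewrite -EFinB /GRing.scale/=; congr EFin; ring.
- apply/continuous_within_itvP => //; split.
  + by move=> x; rewrite in_itv/= => /andP[/(lt_trans a0) x0 _]; exact: continuous_at_powR.
  + by apply: cvg_at_right_filter; exact: continuous_at_powR.
  + by apply: cvg_at_left_filter; apply: continuous_at_powR; exact: lt_trans ab.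
- have H (x : R) : 0 < x -> {for x, continuous (fun x => (p + 1)^-1 *: (x `^ (p + 1)))}.
    by move=> x0; apply/differentiable_continuous/derivable1_diffP; case: (dF _ x0).
  split.
  + by move=> x; rewrite in_itv/= => /andP[/(lt_trans a0) x0 _]; case: (dF _ x0).
  + by apply: cvg_at_right_filter; exact: H.
  + by apply: cvg_at_left_filter; apply: H; exact: lt_trans ab.
- move=> x; rewrite in_itv/= => /andP[/(lt_trans a0) x0 _].
  by rewrite derive1E; case: (dF _ x0).
Qed.

(** For [p < 0] the integrand is unbounded at 0, out of reach of the fundamental theorem of
    calculus. The intervals [t/(n+2), t] exhaust ]0, t], and monotone convergence passes to the
    limit. *)
Lemma integral_powR_oc (t p : R) : 0 < t -> -1 < p ->
  (\int[mu]_(x in `]0%R, t]) (x `^ p)%:E = (t `^ (p + 1) / (p + 1))%:E)%E.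
Proof.
move=> t0 p1.
have p1' : 0 < p + 1 by rewrite -ltrBlDr sub0r.
(* The offset 2 keeps [a n < t] strict already at [n = 0], as [integral_powR_cc] asks. *)
pose a n : R := t / n.+2%:R.
have a0 n : 0 < a n by rewrite divr_gt0// ltr0n.
have at_ n : a n < t by rewrite ltr_pdivrMr ?ltr0n// ltr_pMr// ltr1n.
have acvg : a n @[n --> \oo] --> 0.
  rewrite -(mulr0 t); apply: cvgMr.
  rewrite (_ : (fun n => _) = (fun n => (n + 1)%N.+1%:R^-1)); last first.
    by apply/funext => n; rewrite addn1.
  by rewrite (cvg_shiftn 1 (fun n => n.+1%:R^-1 : R)); exact: cvg_harmonic.
have := @ge0_nondecreasing_set_cvg_integral _ (measurableTypeR R) R (fun n => `[a n, t]%classic)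
  (fun x => (x `^ p)%:E) mu.
have -> : \bigcup_n `[a n, t]%classic = `]0%R, t]%classic.
  apply/seteqP; split => x /=.
    by move=> [n _] /=; rewrite !in_itv/= => /andP[/(lt_le_trans (a0 n)) -> ->].
  rewrite in_itv/= => /andP[x0 xt].
  have : \forall n \near \oo, a n < x.
    by move/cvgrPdist_lt : acvg => /(_ _ x0); apply: filterS => n;
      rewrite sub0r normrN ger0_norm// ltW.
  case=> N _ /(_ N (leqnn _)) aN; exists N => //=.
  by rewrite in_itv/= xt ltW.
move=> H; apply: (cvg_unique _ (H _ _ _ _)) => {H} //.
- apply/nondecreasing_seqP => n; rewrite subsetEset => x /=.
  rewrite !in_itv/= => /andP[h ->]; rewrite andbT (le_trans _ h)//.
  by rewrite ler_pM2l// lef_pV2 ?posrE ?ltr0n// ler_nat.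
- by move=> n; apply/measurable_EFinP; apply: measurable_funS (measurable_powR _).
- by move=> n x _; rewrite lee_fin powR_ge0.
rewrite /=; apply: cvg_trans (_ : (((t `^ (p + 1) - a n `^ (p + 1)) / (p + 1))%:E
  @[n --> \oo] --> (t `^ (p + 1) / (p + 1))%:E)%E).
  by apply: near_eq_cvg; near=> n; rewrite integral_powR_cc// gt_eqF.
apply: cvg_EFin; first exact: nearW.
rewrite -[t `^ (p + 1) in X in _ --> X]subr0.
apply: cvgMl; apply: cvgB; first exact: cvg_cst.
have /cvg_at_rightP := powR_cvg0 p1'; apply; split => //.
Unshelve. all: by end_near. Qed.

Lemma integral_powR_oo (t p : R) : 0 < t -> -1 < p ->
  (\int[mu]_(x in `]0%R, t[) (x `^ p)%:E = (t `^ (p + 1) / (p + 1))%:E)%E.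
Proof.
move=> t0 p1; rewrite integral_itv_bndo_bndc ?integral_powR_oc//.
by apply/measurable_EFinP; apply: measurable_funS (measurable_powR _).
Qed.

End PowRIntegral.

(** * Euler's integral for Gamma: finiteness, positivity, value at 1 *)

Section EulerGamma.
Context {R : realType}.
Local Notation mu := (@lebesgue_measure R).
Implicit Types x t : R.

Definition gamma_integrand x t : R := t `^ (x - 1) * expR (- t).

Lemma measurable_gamma_integrand x : measurable_fun setT (gamma_integrand x).
Proof.
apply: measurable_funM; first exact: measurable_powR.
by apply: measurableT_comp; [exact: measurable_expR|exact: oppr_measurable].
Qed.

Lemma gamma_integrand_ge0 x t : 0 <= gamma_integrand x t.
Proof. by rewrite mulr_ge0 ?powR_ge0 ?expR_ge0. Qed.

(** Comparison with a single term of the exponential series at t/2, of degree at least [y]. The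
    halved rate leaves a factor exp(-t/2) to integrate at infinity. *)
Lemma powR_le_expR (y : R) : exists2 C : R, 0 <= C &
  forall t, 1 <= t -> t `^ y <= C * expR (2^-1 * t).
Proof.
pose n := Num.bound y.
exists (2 ^+ n.+1 * n.+1`!%:R); first by rewrite mulr_ge0// exprn_ge0.
move=> t t1; have t0 : 0 <= t by rewrite (le_trans _ t1).
apply: (@le_trans _ _ (t ^+ n.+1)).
  rewrite -powR_mulrn//; apply: ler_powR => //.
  rewrite (le_trans (ler_norm _))// (le_trans (ltW (archi_boundP _)))//.
  by rewrite ler_nat /n /Num.bound normr_id.
have := @expR_ge1Dxn R (2^-1 * t) n; rewrite mulr_ge0// => /(_ isT) H.
have {}H : (2^-1 * t) ^+ n.+1 / n.+1`!%:R <= expR (2^-1 * t).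
  by rewrite (le_trans _ H)// lerDr.
move: H; rewrite ler_pdivrMr ?ltr0n ?fact_gt0// exprMn => H.
rewrite -mulrA [n.+1`!%:R * _]mulrC -ler_pdivrMl ?exprn_gt0//.
by rewrite -exprVn.
Qed.

(** Split at 1: t^(x-1) dominates near 0, and a multiple of the exponential density of rate 1/2
    dominates at infinity. *)
Lemma gamma_integral_lty x : 0 < x ->
  (\int[mu]_(t in `]0%R, +oo[) (gamma_integrand x t)%:E < +oo)%E.
Proof.
move=> x0; have mg := measurable_gamma_integrand x.
have -> : `]0, +oo[%classic = `]0, 1] `|` `]1, +oo[ :> set R.
  by rewrite -itv_bndbnd_setU// bnd_simp.
rewrite ge0_integral_setU//; last 3 first.
- by apply/measurable_EFinP; exact: measurable_funTS.
- by move=> t _; rewrite lee_fin gamma_integrand_ge0.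
- by apply: lt_disjoint => s t; rewrite !in_itv/= => /andP[_ /le_lt_trans h] /andP[/h].
apply: lte_add_pinfty.
  apply: (@le_lt_trans _ _ (\int[mu]_(t in `]0%R, 1%R]) (t `^ (x - 1))%:E)%E).
    apply: ge0_le_integral => //.
    - by move=> t _; rewrite lee_fin gamma_integrand_ge0.
    - by apply/measurable_EFinP; exact: measurable_funTS.
    - by apply/measurable_EFinP; apply: measurable_funTS; exact: measurable_powR.
    - move=> t; rewrite /= in_itv/= => /andP[t0 _]; rewrite lee_fin /gamma_integrand.
      by rewrite ler_piMr ?powR_ge0// -expR0 ler_expR lerNl oppr0 ltW.
  by rewrite integral_powR_oc ?ltrBrDr ?addNr// ltry.
have [C C0 HC] := powR_le_expR (x - 1).
have h0 : 0 <= 2^-1 :> R by rewrite invr_ge0.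
(* The factor 2 cancels the rate 1/2 in front of the density. *)
apply: (@le_lt_trans _ _
  (\int[mu]_(t in `]1%R, +oo[) ((C * 2)%:E * (exponential_pdf 2^-1 t)%:E))%E).
  apply: ge0_le_integral => //.
  - by move=> t _; rewrite lee_fin gamma_integrand_ge0.
  - by apply/measurable_EFinP; exact: measurable_funTS.
  - apply: measurable_funeM; apply/measurable_EFinP; apply: measurable_funTS.
    exact: measurable_exponential_pdf.
  move=> t; rewrite /= in_itv/= andbT => t1; rewrite -EFinM lee_fin.
  have t0 : 0 <= t by rewrite (le_trans _ (ltW t1)).
  rewrite exponential_pdfE// /gamma_integrand mulrA mulfK//.
  have -> : expR (- t) = expR (- (2^-1 * t)) * expR (- 2^-1 * t).
    by rewrite -expRD; congr expR; field.
  rewrite mulrA ler_wpM2r ?expR_ge0// -ler_pdivlMr ?expR_gt0//.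
  by rewrite expRN invrK HC// ltW.
rewrite ge0_integralZl//; last 3 first.
- by apply/measurable_EFinP; apply: measurable_funTS; exact: measurable_exponential_pdf.
- by move=> t _; rewrite lee_fin exponential_pdf_ge0.
- by rewrite lee_fin mulr_ge0.
rewrite lte_mul_pinfty ?lee_fin ?mulr_ge0//.
apply: (@le_lt_trans _ _ (\int[mu]_t (exponential_pdf 2^-1 t)%:E)%E).
  apply: ge0_subset_integral => //.
    by apply/measurable_EFinP; exact: measurable_exponential_pdf.
  by move=> t _; rewrite lee_fin exponential_pdf_ge0.
by rewrite integral_exponential_pdf ?ltry// invr_gt0.
Qed.

Lemma EFin_euler_gamma x : 0 < x ->
  (euler_gamma x)%:E = (\int[mu]_(t in `]0%R, +oo[) (gamma_integrand x t)%:E)%E.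
Proof.
move=> x0; rewrite /euler_gamma /Rintegral fineK// ge0_fin_numE.
  exact: gamma_integral_lty.
by apply: integral_ge0 => t _; rewrite lee_fin gamma_integrand_ge0.
Qed.

Lemma euler_gamma_gt0 x : 0 < x -> 0 < euler_gamma x.
Proof.
move=> x0; rewrite -lte_fin EFin_euler_gamma//.
(* On [1, 2] the power is monotone, so its least value is at an endpoint; exp(-t) is least at 2. *)
pose c : R := Num.min 1 (2 `^ (x - 1)) * expR (- 2).
have c0 : 0 < c by rewrite mulr_gt0 ?expR_gt0// lt_min ltr01 powR_gt0.
apply: (@lt_le_trans _ _ (\int[mu]_(t in `[1%R, 2%R]) (cst c%:E t))%E).
  by rewrite integral_cst//= lebesgue_measure_itv/= lte_fin ltr1n -EFinB -EFinM
    lte_fin mulr_gt0// subr_gt0 ltr1n.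
apply: (@le_trans _ _ (\int[mu]_(t in `[1%R, 2%R]) (gamma_integrand x t)%:E)%E).
  apply: ge0_le_integral => //.
  - by move=> t _; rewrite lee_fin ltW.
  - by apply/measurable_EFinP; apply: measurable_funTS; exact: measurable_gamma_integrand.
  move=> t; rewrite /= in_itv/= => /andP[t1 t2]; rewrite lee_fin.
  rewrite ler_pM ?expR_ge0 ?le_min ?ler01 ?powR_ge0//; last by rewrite ler_expR lerN2.
  rewrite ge_min; have [x1|x1] := leP 0 (x - 1).
    by rewrite -[X in X <= _](powRr0 t) ler_powR.
  have t0 : 0 < t by rewrite (lt_le_trans _ t1).
  suff -> : 2 `^ (x - 1) <= t `^ (x - 1) by rewrite orbT.
  rewrite -[x - 1]opprK !(powRN _ (- (x - 1))) lef_pV2 ?posrE ?powR_gt0//.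
  by apply: ge0_ler_powR => //; rewrite ?nnegrE ?oppr_ge0 ltW.
apply: ge0_subset_integral => //.
- by apply/measurable_EFinP; apply: measurable_funTS; exact: measurable_gamma_integrand.
- by move=> t _; rewrite lee_fin gamma_integrand_ge0.
- by move=> t /=; rewrite !in_itv/= andbT => /andP[/(lt_le_trans ltr01)].
Qed.

Lemma euler_gamma1 : euler_gamma 1 = 1 :> R.
Proof.
apply: EFin_inj; rewrite EFin_euler_gamma//.
rewrite -(@integral_exponential_pdf R 1)// /exponential_pdf.
rewrite integral_itv_obnd_cbnd; last first.
  by apply/measurable_EFinP; apply: measurable_funTS; exact: measurable_gamma_integrand.
rewrite integral_mkcond; apply: eq_integral => t _.
rewrite restrict_EFin; congr (EFin (patch _ _ _ _)); apply/funext => s.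
by rewrite /gamma_integrand subrr powRr0 !mul1r mulN1r.
Qed.
End EulerGamma.

(** * The Beta integral and its relation to Gamma *)

Section BetaIntegral.
Context {R : realType}.
Local Notation mu := (@lebesgue_measure R).
Implicit Types a b s t x u : R.

(** Affine substitution and Tonelli are applied on the whole line and plane, so domains are turned
    into conditions inside the integrand. *)
Lemma integral_itv_if (i : interval R) (g : R -> \bar R) :
  (\int[mu]_(x in [set` i]) g x = \int[mu]_x (if x \in i then g x else 0))%E.
Proof.
by rewrite integral_mkcond; apply: eq_integral => x _; rewrite patchE mem_setE.
Qed.

Lemma powRD_gt0 r s t : 0 < t -> t `^ (r + s) = t `^ r * t `^ s.
Proof. by move=> t0; rewrite powRD// (gt_eqF t0) implybT. Qed.

Lemma measurable_lt2 d (T : measurableType d) (f g h : T -> R) :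
  measurable_fun setT f -> measurable_fun setT g -> measurable_fun setT h ->
  measurable_fun setT (fun z => f z < g z < h z).
Proof. by move=> *; apply: measurable_and; apply: measurable_fun_ltr. Qed.

Definition convolution_integrand a b t s : R := s `^ (a - 1) * (t - s) `^ (b - 1).

Lemma convolution_integrand_ge0 a b t s : 0 <= convolution_integrand a b t s.
Proof. by rewrite mulr_ge0 ?powR_ge0. Qed.

Lemma measurable_convolution_integrand d (T : measurableType d) a b (f g : T -> R) :
  measurable_fun setT f -> measurable_fun setT g ->
  measurable_fun setT (fun z => convolution_integrand a b (f z) (g z)).
Proof.
move=> mf mg; apply: measurable_funM.
  by apply: (measurableT_comp (measurable_powR _)).
by apply: (measurableT_comp (measurable_powR _)); apply: measurable_funB.
Qed.

(** Extended-real valued: finiteness is deduced from [euler_gammaM], which already involves this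
    integral. *)
Definition beta_integral a b : \bar R :=
  (\int[mu]_(s in `]0%R, 1%R[) (convolution_integrand a b 1 s)%:E)%E.

Lemma convolution_integral a b t : 0 < t ->
  (\int[mu]_(s in `]0%R, t[) (convolution_integrand a b t s)%:E =
   (t `^ (a + b - 1))%:E * beta_integral a b)%E.
Proof.
move=> t0; rewrite integral_itv_if (@ge0_integral_affine _ t 0)//; last 2 first.
- apply: measurable_fun_ifT => //.
    under eq_fun do rewrite in_itv/=.
    by apply: measurable_lt2.
  by apply/measurable_EFinP; apply: measurable_convolution_integrand.
- by move=> x; case: ifP => // _; rewrite lee_fin convolution_integrand_ge0.
rewrite -ge0_integralZl; last 4 first.
- by [].
- apply: measurable_fun_ifT => //.
    under eq_fun do rewrite in_itv/=.
    by apply: measurable_lt2 => //; apply: measurable_funD => //; apply: measurable_funM.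
  apply/measurable_EFinP; apply: measurable_convolution_integrand => //.
  by apply: measurable_funD => //; apply: measurable_funM.
- by move=> x; case: ifP => // _; rewrite lee_fin convolution_integrand_ge0.
- by rewrite lee_fin ltW.
rewrite /beta_integral -ge0_integralZl; last 4 first.
- by [].
- by apply/measurable_EFinP; apply: measurable_funTS; apply: measurable_convolution_integrand.
- by move=> s _; rewrite lee_fin convolution_integrand_ge0.
- by rewrite lee_fin powR_ge0.
rewrite [RHS]integral_itv_if; apply: eq_integral => s _.
rewrite !in_itv/= addr0 pmulr_rgt0// gtr_pMr//.
case: ifPn => [/andP[s0 s1]|]; last by rewrite mule0.
rewrite -!EFinM; congr EFin.
rewrite /convolution_integrand (_ : t - t * s = t * (1 - s)); last by ring.
rewrite !powRM ?ltW// ?subr_gt0//.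
rewrite (_ : a + b - 1 = 1 + (a - 1) + (b - 1)); last by ring.
rewrite (powRD_gt0 (1 + (a - 1)) (b - 1) t0) (powRD_gt0 1 (a - 1) t0) (powRr1 (ltW t0)); ring.
Qed.

Lemma beta_integral_ge0 a b : (0 <= beta_integral a b)%E.
Proof. by apply: integral_ge0 => s _; rewrite lee_fin convolution_integrand_ge0. Qed.

(** Both sides are the integral over 0 < x < u of x^(a-1) (u-x)^(b-1) exp(-u). For fixed x the shift
    u = x + y separates it into the product; for fixed u, [convolution_integral] extracts
    u^(a+b-1). *)
Lemma euler_gammaM a b : 0 < a -> 0 < b ->
  ((euler_gamma a * euler_gamma b)%:E =
   (euler_gamma (a + b))%:E * beta_integral a b)%E.
Proof.
move=> a0 b0.
pose f (z : R * R) : \bar R := (if 0 < z.1 < z.2 then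
   convolution_integrand a b z.2 z.1 * expR (- z.2) else 0)%:E.
have mf : measurable_fun setT f.
  apply/measurable_EFinP; apply: measurable_fun_ifT => //; first exact: measurable_lt2.
  apply: measurable_funM; first exact: measurable_convolution_integrand.
  by apply: (measurableT_comp (@measurable_expR R)); apply: measurable_funN.
have f0 z : (0 <= f z)%E.
  by rewrite lee_fin; case: ifP => // _; rewrite mulr_ge0 ?expR_ge0 ?convolution_integrand_ge0.
transitivity (\int[mu]_x \int[mu]_u f (x, u))%E; last first.
  rewrite (@fubini_tonelli _ _ _ _ _ mu mu f mf f0) EFin_euler_gamma ?addr_gt0//.
  rewrite -ge0_integralZr//; last 3 first.
  - by apply/measurable_EFinP; apply: measurable_funTS; exact: measurable_gamma_integrand.
  - by move=> u _; rewrite lee_fin gamma_integrand_ge0.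
  - exact: beta_integral_ge0.
  rewrite [RHS]integral_itv_if; apply: eq_integral => u _; rewrite in_itv/= andbT.
  case: ifPn => u0; last first.
    rewrite integral0_eq// => x _; rewrite /f/=; case: ifPn => // /andP[x0 xu].
    by rewrite (lt_trans x0 xu) in u0.
  rewrite muleC EFinM [in RHS]muleC muleAC -convolution_integral// -ge0_integralZr//; last 2 first.
  - by apply/measurable_EFinP; apply: measurable_funTS; apply: measurable_convolution_integrand.
  - by move=> s _; rewrite lee_fin convolution_integrand_ge0.
  rewrite [RHS]integral_itv_if; apply: eq_integral => x _; rewrite in_itv/= /f/=.
  by case: ifP.
rewrite EFinM muleC EFin_euler_gamma// [X in (_ * X)%E]EFin_euler_gamma//.
rewrite -ge0_integralZl//; last 3 first.
- by apply/measurable_EFinP; apply: measurable_funTS; exact: measurable_gamma_integrand.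
- by move=> u _; rewrite lee_fin gamma_integrand_ge0.
- by apply: integral_ge0 => u _; rewrite lee_fin gamma_integrand_ge0.
rewrite [LHS]integral_itv_if; apply: eq_integral => x _; rewrite in_itv/= andbT.
case: ifPn => x0; last by rewrite integral0_eq// => u _; rewrite /f/= (negbTE x0).
rewrite [RHS](@ge0_integral_affine _ 1 x)//; last exact: measurableT_comp mf (measurable_pair1 x).
rewrite mul1e -ge0_integralZr//; last 3 first.
- by apply/measurable_EFinP; apply: measurable_funTS; exact: measurable_gamma_integrand.
- by move=> u _; rewrite lee_fin gamma_integrand_ge0.
- by rewrite lee_fin gamma_integrand_ge0.
rewrite [LHS]integral_itv_if; apply: eq_integral => y _; rewrite in_itv/= andbT.
rewrite /f/= x0/= mul1r ltrDr; case: ifP => // _.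
rewrite -EFinM /gamma_integrand /convolution_integrand addrK opprD expRD; congr EFin; ring.
Qed.

End BetaIntegral.

(** * Functional equation of Gamma and the Beta formula *)

Section GammaTheory.
Context {R : realType}.
Local Notation mu := (@lebesgue_measure R).
Implicit Types x a b : R.

Lemma rising0 x : rising x 0 = 1.
Proof. by rewrite /rising big_ord0. Qed.

Lemma risingS x n : rising x n.+1 = rising x n * (x + n%:R).
Proof. by rewrite /rising big_ord_recr. Qed.

Lemma risingSl x n : rising x n.+1 = x * rising (x + 1) n.
Proof.
rewrite /rising big_ord_recl addr0; congr (_ * _); apply: eq_bigr => i _.
by rewrite -addrA -nat1r.
Qed.

Lemma rising_gt0 x n : 0 < x -> 0 < rising x n.
Proof. by move=> x0; apply: prodr_gt0 => i _; rewrite ltr_pwDl. Qed.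

Lemma beta_integral_1r x : 0 < x -> beta_integral x 1 = (x^-1)%:E.
Proof.
move=> x0; transitivity (\int[mu]_(s in `]0%R, 1%R[) (s `^ (x - 1))%:E)%E; last first.
  by rewrite integral_powR_oo// ?ltrBrDr ?addNr// subrK powR1 div1r.
by apply: eq_integral => s _; rewrite /convolution_integrand subrr powRr0 mulr1.
Qed.

(** Instead of an integration by parts: the product formula with second argument 1, where the Beta
    integral is 1/x. *)
Lemma euler_gammaS x : 0 < x -> euler_gamma (x + 1) = x * euler_gamma x.
Proof.
move=> x0; have := euler_gammaM x0 ltr01.
by rewrite beta_integral_1r// -EFinM euler_gamma1 mulr1 => -[->]; rewrite mulrCA divff ?mulr1 ?gt_eqF.
Qed.

Lemma Gamma_pos x : 0 < x -> Gamma x = euler_gamma x.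
Proof. by move=> x0; rewrite /Gamma x0 addr0 rising0 divr1. Qed.

Lemma Gamma_gt0 x : 0 < x -> 0 < Gamma x.
Proof. by move=> x0; rewrite Gamma_pos// euler_gamma_gt0. Qed.

Lemma GammaD_nat x n : 0 < x -> Gamma (x + n%:R) = rising x n * Gamma x.
Proof.
move=> x0; elim: n => [|n IH]; first by rewrite addr0 rising0 mul1r.
rewrite -natr1 addrA Gamma_pos ?ltr_pwDl ?ler0n// ?ltr_wpDr//.
by rewrite euler_gammaS ?ltr_wpDr// -Gamma_pos ?ltr_wpDr// IH risingS mulrCA mulrA.
Qed.

Lemma rising1 n : rising 1 n = n`!%:R :> R.
Proof. by elim: n => [|n IH]; rewrite ?rising0// risingS IH factS natrM mulrC nat1r. Qed.

Lemma Gamma_nat n : Gamma (1 + n%:R) = n`!%:R :> R.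
Proof. by rewrite GammaD_nat// rising1 Gamma_pos// euler_gamma1 mulr1. Qed.

(** Negative x are needed for Gamma(1/2 - H) with H > 1/2. There the definition of [Gamma] shifts by
    exactly one, and is the claim solved for [Gamma x]. *)
Lemma GammaS x : -1 < x -> x != 0 -> Gamma (x + 1) = x * Gamma x.
Proof.
move=> x1 xn0; have [x0|x0] := ltP 0 x.
  by rewrite -[1]/(1%:R) GammaD_nat// risingS rising0 mul1r addr0.
have xp : 0 < x + 1 by rewrite -ltrBlDr sub0r.
rewrite [in RHS]/Gamma ltNge x0/=.
have -> : Num.truncn (- x) = 0%N.
  by apply/truncn0Pn; rewrite -ltNge ltrNl.
by rewrite risingS rising0 mul1r addr0 Gamma_pos// mulrCA divff// mulr1.
Qed.

(** In [euler_gammaM] the left side is real and the Gamma factor on the right is positive, so an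
    infinite Beta integral is impossible; division gives the value. *)
Lemma beta_integralE a b : 0 < a -> 0 < b ->
  beta_integral a b = (Gamma a * Gamma b / Gamma (a + b))%:E.
Proof.
move=> a0 b0; rewrite !Gamma_pos ?addr_gt0//.
have g0 := euler_gamma_gt0 (addr_gt0 a0 b0).
have := euler_gammaM a0 b0.
case E : (beta_integral a b) => [r| |].
- by rewrite -EFinM => -[->]; rewrite [_ * r]mulrC mulfK ?gt_eqF.
- by rewrite gt0_muley ?lte_fin.
- by rewrite gt0_muleNy ?lte_fin.
Qed.

Lemma convolution_integralE a b (t : R) : 0 < a -> 0 < b -> 0 < t ->
  (\int[mu]_(s in `]0%R, t[) (convolution_integrand a b t s)%:E =
   (Gamma a * Gamma b / Gamma (a + b) * t `^ (a + b - 1))%:E)%E.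
Proof.
by move=> a0 b0 t0; rewrite convolution_integral// beta_integralE// -EFinM mulrC.
Qed.

End GammaTheory.

(** * Power series and the identity theorem on a half-line *)

Section PowerSeries.
Context {R : realType}.
Implicit Types (u v : R^nat) (x y l r e : R).

Lemma pseriesS u y n :
  pseries u y n.+1 = u 0%N + y * pseries (fun k => u k.+1) y n.
Proof.
rewrite /pseries /series/= big_nat_recl//= expr0 mulr1 mulr_sumr.
by congr (_ + _); apply: eq_bigr => i _; rewrite exprS mulrCA.
Qed.

Lemma eq_cvgn (f g : R^nat) l : f =1 g -> f @ \oo --> l -> g @ \oo --> l.
Proof. by move=> /funext ->. Qed.

Lemma cvg_pseriesD u v y l l' :
  pseries u y @ \oo --> l -> pseries v y @ \oo --> l' ->
  pseries (fun k => u k + v k) y @ \oo --> l + l'.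
Proof.
move=> ul vl; apply: (@eq_cvgn (fun n => pseries u y n + pseries v y n)); last exact: cvgD.
move=> n.
by rewrite /pseries /series/= -big_split/=; apply: eq_bigr => i _; rewrite mulrDl.
Qed.

Lemma cvg_pseriesZ c u y l :
  pseries u y @ \oo --> l -> pseries (fun k => c * u k) y @ \oo --> c * l.
Proof.
move=> ul; apply: (@eq_cvgn (fun n => c * pseries u y n)) => [n|]; last exact: cvgMr.
by rewrite /pseries /series/= mulr_sumr; apply: eq_bigr => i _; rewrite mulrA.
Qed.

Definition shift_coef u : R^nat := fun k => if k is k'.+1 then u k' else 0.

Lemma cvg_pseries_shift u y l :
  pseries u y @ \oo --> l -> pseries (shift_coef u) y @ \oo --> y * l.
Proof.
move=> ul; rewrite -cvg_shiftS; apply: (@eq_cvgn (fun n => y * pseries u y n)) => [n|]; last exact: cvgMr.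
by rewrite /= pseriesS add0r.
Qed.

Lemma cvg_pseries_unshift u y l : y != 0 ->
  pseries u y @ \oo --> l ->
  pseries (fun k => u k.+1) y @ \oo --> (l - u 0%N) / y.
Proof.
move=> y0; rewrite -cvg_shiftS => ul.
apply: (@eq_cvgn (fun n => (pseries u y n.+1 - u 0%N) / y)) => [n|]; last first.
  by apply: cvgMl; apply: cvgB => //; exact: cvg_cst.
by rewrite pseriesS addrC addKr mulrC mulKf.
Qed.

(** Convergence at [y0] bounds all terms u_k y0^k by one [M]; within half that radius the rest is
    dominated by a geometric series of ratio 1/2. The bound is uniform in [n], so it survives the
    limit. *)
Lemma pseries_le_linear u y0 : 0 < y0 -> cvgn (pseries u y0) ->
  exists2 C : R, 0 <= C &
    forall y n, `|y| <= y0 / 2 -> `|pseries u y n.+1 - u 0%N| <= C * `|y|.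
Proof.
move=> y00 cu.
have [M M0 HM] : exists2 M : R, 0 <= M & forall k, `|u k * y0 ^+ k| <= M.
  have := cvg_series_cvg_0 cu => /cvgP/cvg_seq_bounded[M [Mr HM]].
  exists (`|M| + 1); first by rewrite addr_ge0.
  by move=> k; apply: HM => //; rewrite ltr_pwDr// ler_norm.
exists (M * 2 / y0); first by rewrite !mulr_ge0// invr_ge0 ltW.
move=> y n hy; rewrite pseriesS addrC addKr normrM mulrC ler_wpM2r//.
rewrite (@le_trans _ _ (\sum_(0 <= k < n) M / y0 * (2^-1) ^+ k))//; last first.
  rewrite -mulr_sumr -!mulrA [2 / _]mulrC !mulrA ler_wpM2l ?mulr_ge0 ?invr_ge0 ?(ltW y00)//.
  have -> : \sum_(0 <= k < n) 2^-1 ^+ k = 2 * (1 - 2^-1 ^+ n) :> R.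
    elim: n => [|n IH]; first by rewrite big_nil expr0 subrr mulr0.
    by rewrite big_nat_recr//= IH exprS; field.
  by rewrite ler_piMr// gerBl exprn_ge0.
rewrite /pseries /series/= (le_trans (ler_norm_sum _ _ _))//.
apply: ler_sum => k _; rewrite normrM normrX.
have -> : M / y0 * 2^-1 ^+ k = M / y0 ^+ k.+1 * (y0 / 2) ^+ k.
  by rewrite exprMn exprS; field; rewrite expf_neq0 ?gt_eqF.
rewrite ler_pM ?exprn_ge0//; last by rewrite lerXn2r ?nnegrE ?divr_ge0 ?(ltW y00).
rewrite ler_pdivlMr ?exprn_gt0//.
by rewrite (le_trans _ (HM k.+1))// normrM [`|y0 ^+ _|]ger0_norm// exprn_ge0// ltW.
Qed.

Lemma pseries_eq0_head u r : 0 < r ->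
  (forall y, 0 < y < r -> pseries u y @ \oo --> 0) -> u 0%N = 0.
Proof.
move=> r0 H.
have r20 : 0 < r / 2 by rewrite divr_gt0.
have : cvgn (pseries u (r / 2)).
  by apply/cvg_ex; exists 0; apply: H; rewrite r20 ltr_pdivrMr// ltr_pMr// ltr1n.
move=> /(pseries_le_linear r20)[C C0 HC].
apply/eqP; rewrite -normr_eq0 eq_le normr_ge0 andbT.
apply/ler_addgt0Pl => /= e e0; rewrite addr0.
(* Small enough for the linear bound to hold and to give C y <= e; [C + 1] avoids dividing by
   zero. *)
pose y := Num.min (r / 2 / 2) (e / (C + 1)).
have C1 : 0 < C + 1 by rewrite ltr_wpDl.
have y0 : 0 < y by rewrite lt_min !divr_gt0.
have yr : y <= r / 2 / 2 by rewrite ge_min lexx.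
apply: (@le_trans _ _ (C * y)); last first.
  apply: (@le_trans _ _ ((C + 1) * y)); first by rewrite ler_wpM2r ?lerDl// ltW.
  by rewrite mulrC -ler_pdivlMr// ge_min lexx orbT.
have : pseries u y @ \oo --> 0.
  by apply: H; rewrite y0/= (le_lt_trans yr)//; lra.
rewrite -cvg_shiftS => uy.
have : `|pseries u y n.+1 - u 0%N| @[n --> \oo] --> `|0 - u 0%N|.
  by apply: cvg_norm; apply: cvgB => //; exact: cvg_cst.
rewrite sub0r normrN => uy'.
apply: (cvgr_to_le uy'); apply: nearW => k.
by rewrite (le_trans (HC _ _ _))// gtr0_norm.
Qed.

(** Once the head coefficient vanishes, y is divided out and the argument repeats. The hypothesis is
    one-sided because [analytic_identity] knows agreement only to the right of the critical
    point. *)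
Lemma pseries_eq0 u r : 0 < r ->
  (forall y, 0 < y < r -> pseries u y @ \oo --> 0) -> forall n, u n = 0.
Proof.
move=> r0 + n; elim: n u => [|n IH] u H; first exact: (pseries_eq0_head r0).
apply: (IH (fun k => u k.+1)) => y /andP[y0 yr].
rewrite [X in _ --> X](_ : 0 = (0 - u 0%N) / y); last first.
  by rewrite (pseries_eq0_head r0 H) subrr mul0r.
by apply: cvg_pseries_unshift; [rewrite gt_eqF|apply: H; rewrite y0].
Qed.

(** Let [s] be the supremum of the points of disagreement. Agreement just right of [s] forces equal
    coefficients at [s], hence agreement on both sides near [s]; yet some point of disagreement lies
    at [s] or arbitrarily close on its left. *)
Lemma analytic_identity (f g : R -> R) (x0 b : R) : x0 < b ->
  (forall x, x < b -> analytic_at f x) -> (forall x, x < b -> analytic_at g x) ->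
  (forall x, x0 < x < b -> f x = g x) -> forall x, x < b -> f x = g x.
Proof.
move=> x0b fa ga fg x xb; apply: contrapT => /eqP fgx.
pose E : set R := [set x | x < b /\ f x != g x].
have Ex : E x by [].
have Eub : ubound E x0.
  move=> y [yb fgy]; rewrite leNgt; apply/negP => x0y.
  by move: fgy; rewrite fg ?eqxx// x0y.
pose s := sup E.
have sx0 : s <= x0 by apply: ge_sup => //; exists x.
have sb : s < b by exact: le_lt_trans x0b.
have Es y : s < y -> y < b -> f y = g y.
  move=> sy yb; apply: contrapT => /eqP fgy.
  suff : y <= s by rewrite leNgt sy.
  by apply: sup_upper_bound => //; split; [exists x|exists x0].
have [r r0 [u fu]] := fa _ sb; have [r' r'0 [v gv]] := ga _ sb.
pose d := Num.min (Num.min r r') (b - s).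
have d0 : 0 < d by rewrite !lt_min r0 r'0 subr_gt0.
have uv n : u n - v n = 0.
  apply: (pseries_eq0 (u := fun n => u n - v n) d0) => y /andP[y0].
  rewrite !lt_min -andbA => /and3P[yr yr' ybs].
  have ys : `|y + s - s| < r by rewrite addrK gtr0_norm.
  have ys' : `|y + s - s| < r' by rewrite addrK gtr0_norm.
  have := cvg_pseriesD (fu _ ys) (cvg_pseriesZ (c := -1) (gv _ ys')).
  rewrite addrK Es ?ltrDr//; last by rewrite -ltrBrDr.
  by rewrite mulN1r subrr; under eq_fun do rewrite mulN1r.
have [z Ez] : exists2 z, E z & s - d < z.
  by apply: sup_gt; [exists x|rewrite ltrBlDr ltrDl].
move=> sz; have zs : z <= s by apply: sup_upper_bound => //; split; [exists x|exists x0].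
have zd : `|z - s| < d by rewrite ler0_norm ?subr_le0// opprB ltrBlDl -ltrBlDr.
case: Ez => _ /eqP; apply.
move: zd; rewrite !lt_min -andbA => /and3P[zr zr' _].
have := gv _ zr'; have <- : u = v by apply/funext => n; apply/eqP; rewrite -subr_eq0 uv.
move=> gz; exact: (cvg_unique _ (fu _ zr) gz).
Qed.

End PowerSeries.

(** * The binomial series *)

Section Binomial.
Context {R : realType}.
Implicit Types (a w q x : R).

Lemma mulr_powRB1_gt0 x a : 0 < x -> x * x `^ (a - 1) = x `^ a.
Proof.
move=> x0; have -> : a = 1 + (a - 1) by ring.
by rewrite (powRD_gt0 1 (a - 1) x0) (powRr1 (ltW x0)) addrAC subrr add0r.
Qed.

(** Coefficient of w^n in (1 - w)^a: the generalized binomial coefficient with the sign (-1)^n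
    included. *)
Definition binomial_coef a n : R := rising (- a) n / n`!%:R.

Lemma binomial_coef0 a : binomial_coef a 0 = 1.
Proof. by rewrite /binomial_coef rising0 divr1. Qed.

Lemma binomial_coefS a n :
  binomial_coef a n.+1 = (n%:R - a) / n.+1%:R * binomial_coef a n.
Proof.
rewrite /binomial_coef risingS factS natrM; field.
by rewrite nat1r !pnatr_eq0 -lt0n fact_gt0.
Qed.

(** Coefficient form of the derivative rule d/dw (1-w)^a = -a (1-w)^(a-1). *)
Lemma binomial_coefB1 a n :
  n.+1%:R * binomial_coef a n.+1 = - a * binomial_coef (a - 1) n.
Proof.
rewrite /binomial_coef risingSl opprB addrC factS natrM; field.
by rewrite nat1r !pnatr_eq0 -lt0n fact_gt0.
Qed.

Lemma ratio_geometric (c : R^nat) q N : 0 < q ->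
  (forall n, (N <= n)%N -> `|c n.+1| <= q * `|c n|) ->
  exists2 C : R, 0 <= C & forall n, `|c n| <= C * q ^+ n.
Proof.
move=> q0 H; exists (\sum_(k < N.+1) `|c k| / q ^+ k).
  by apply: sumr_ge0 => k _; rewrite divr_ge0// exprn_ge0// ltW.
have small n : (n <= N)%N -> `|c n| <= (\sum_(k < N.+1) `|c k| / q ^+ k) * q ^+ n.
  rewrite -ltnS => nN; rewrite -ler_pdivrMr ?exprn_gt0//.
  rewrite (bigD1 (Ordinal nN))//= lerDl; apply: sumr_ge0 => k _.
  by rewrite divr_ge0// exprn_ge0// ltW.
elim=> [|n IH]; first exact: small.
have [nN|Nn] := ltnP n N; first exact: small.
by rewrite (le_trans (H _ Nn))// exprS mulrCA ler_wpM2l// ltW.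
Qed.

(** Consecutive terms have ratio |n - a| r / (n+1), at most the midpoint [q] of [r] and 1 as soon as
    n (q - r) >= |a|; this fixes [N]. *)
Lemma binomial_geometric a (r : R) : 0 < r < 1 -> exists q C : R,
  [/\ 0 < q < 1, 0 <= C & forall n, `|binomial_coef a n| * r ^+ n <= C * q ^+ n].
Proof.
move=> /andP[r0 r1]; pose q := (1 + r) / 2.
have q01 : 0 < q < 1 by rewrite /q; apply/andP; split; lra.
have qr : 0 < q - r by rewrite /q; lra.
have [q0 q1] := andP q01.
pose N := Num.bound (`|a| / (q - r)).
have [|C C0 HC] := @ratio_geometric (fun n => binomial_coef a n * r ^+ n) q N q0.
  move=> n Nn; rewrite binomial_coefS exprS.
  rewrite -[X in `|X|](_ : (n%:R - a) / n.+1%:R * r * (binomial_coef a n * r ^+ n) = _); last by ring.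
  rewrite normrM ler_wpM2r//.
  rewrite !normrM normfV [`|n.+1%:R|]ger0_norm// [`|r|]gtr0_norm// mulrAC.
  rewrite ler_pdivrMr ?ltr0n//.
  apply: (@le_trans _ _ ((n%:R + `|a|) * r)).
    by rewrite ler_wpM2r ?(ltW r0)// (le_trans (ler_normB _ _))// ger0_norm.
  have : `|a| <= n%:R * (q - r).
    rewrite -ler_pdivrMr// (le_trans (ltW (archi_boundP _)))//; last by rewrite ler_nat.
    by rewrite divr_ge0// ltW.
  rewrite -natr1; have : `|a| * r <= `|a| by rewrite ler_piMr// ltW.
  by nra.
exists q, C; split => // n; rewrite (le_trans _ (HC n))//.
by rewrite [leRHS]normrM [`|r ^+ n|]ger0_norm// exprn_ge0// ltW.
Qed.

Lemma binomial_cvg_norm a (r : R) : 0 <= r < 1 ->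
  cvgn (series (fun n => `|binomial_coef a n| * r ^+ n)).
Proof.
move=> /andP[r0 r1]; have [q [C [/andP[q0 q1] C0 HC]]] : exists q C : R,
  [/\ 0 < q < 1, 0 <= C & forall n, `|binomial_coef a n| * r ^+ n <= C * q ^+ n].
  (* Here [r] may be 0, while [binomial_geometric] wants a positive radius, so a larger one is
     used. *)
  have r' : 0 < (r + 1) / 2 < 1 by apply/andP; split; lra.
  have [q [C [q01 C0 HC]]] := binomial_geometric a r'.
  exists q, C; split => // n; rewrite (le_trans _ (HC n))// ler_wpM2l//.
  by rewrite lerXn2r ?nnegrE//; lra.
apply: (@series_le_cvg _ _ (geometric C q)) => //.
- by move=> n; rewrite mulr_ge0// exprn_ge0.
- by move=> n; rewrite /geometric/= mulr_ge0// exprn_ge0// ltW.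
- by apply: is_cvg_geometric_series; rewrite gtr0_norm.
Qed.

Lemma is_cvg_pseries_binomial a w : `|w| < 1 -> cvgn (pseries (binomial_coef a) w).
Proof.
move=> w1; apply: normed_cvg.
have := @binomial_cvg_norm a `|w|; rewrite normr_ge0 => /(_ w1).
by under [in X in X -> _]eq_fun do rewrite -normrX -normrM.
Qed.

Definition binomial_sum a w : R := limn (pseries (binomial_coef a) w).

Lemma cvg_binomial_sum a w : `|w| < 1 ->
  pseries (binomial_coef a) w @ \oo --> binomial_sum a w.
Proof. exact: is_cvg_pseries_binomial. Qed.

(** Multiplication by 1 - w is the Pascal rule c_(n+1)(a) = c_(n+1)(a-1) - c_n(a-1) for the
    coefficients. *)
Lemma binomial_sumB1 a w : `|w| < 1 ->
  (1 - w) * binomial_sum (a - 1) w = binomial_sum a w.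
Proof.
move=> w1; have H := @cvg_binomial_sum (a - 1) w w1.
apply: (cvg_unique _ _ (@cvg_binomial_sum a w w1)) => //.
have := cvg_pseriesD H (cvg_pseriesZ (c := -1) (cvg_pseries_shift H)).
rewrite mulN1r mulrBl mul1r; apply: eq_cvgn => m.
congr (pseries _ _ m); apply/funext => -[|n].
  by rewrite !binomial_coef0 mulr0 addr0.
rewrite /shift_coef binomial_coefS; apply: (mulfI (_ : n.+1%:R != 0 :> R)).
  by rewrite pnatr_eq0.
rewrite binomial_coefB1 mulrDr.
have -> : n.+1%:R * ((n%:R - (a - 1)) / n.+1%:R * binomial_coef (a - 1) n) =
    (n.+1%:R - a) * binomial_coef (a - 1) n.
  by rewrite -natr1; field; rewrite natr1 pnatr_eq0.
ring.
Qed.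

Lemma is_derive_binomial_sum a w : `|w| < 1 ->
  is_derive w 1 (binomial_sum a) (- a * binomial_sum (a - 1) w).
Proof.
(* A radius strictly between |w| and 1, at which the series and its first two formal derivatives
   converge, as termwise differentiation requires. *)
move=> w1; pose K := (1 + `|w|) / 2.
have wK : `|w| < K by rewrite /K; lra.
have K1 : K < 1 by rewrite /K; lra.
have K0 : 0 < K by rewrite (le_lt_trans _ wK).
have nK : `|K| < 1 by rewrite gtr0_norm.
have E b : pseries_diffs (binomial_coef b) = (fun n => - b * binomial_coef (b - 1) n).
  by apply/funext => n; rewrite /pseries_diffs binomial_coefB1.
have cE b c x : `|x| < 1 -> pseries (fun n => c * binomial_coef b n) x @ \oo --> c * binomial_sum b x.
  by move=> x1; apply: cvg_pseriesZ; exact: cvg_binomial_sum.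
have := @pseries_snd_diffs R (binomial_coef a) K w.
rewrite E (cvg_lim _ (cE _ _ _ w1))//; apply.
- exact: is_cvg_pseries_binomial.
- by apply/cvg_ex; eexists; exact: cE nK.
- rewrite [pseries_diffs _](_ : _ = (fun n => - a * - (a - 1) * binomial_coef (a - 1 - 1) n)).
    by apply/cvg_ex; eexists; exact: cE nK.
  apply/funext => n; by rewrite /pseries_diffs mulrCA binomial_coefB1 mulrA.
- by rewrite (gtr0_norm K0).
Qed.

Lemma is_derive_powR_onem p w : w < 1 ->
  is_derive w 1 (fun w => (1 - w) `^ p) (- (p * (1 - w) `^ (p - 1))).
Proof.
move=> w1; rewrite -[- (p * _)]mulrN1.
apply: (@is_derive1_comp _ (@powR R ^~ p) (fun w => 1 - w)).
  by apply: is_derive1_powR; rewrite subr_gt0.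
rewrite -[X in is_derive _ _ _ X]add0r; apply: is_deriveB.
Qed.

Lemma binomial_sumE a w : `|w| < 1 -> binomial_sum a w = (1 - w) `^ a.
Proof.
(* [g] has zero derivative, hence is constant. *)
pose g x := binomial_sum a x * (1 - x) `^ (- a).
have dg x : `|x| < 1 -> is_derive x 1 g 0.
  move=> x1; have xlt1 : x < 1 by rewrite (le_lt_trans (ler_norm _)).
  have x10 : 0 < 1 - x by rewrite subr_gt0.
  have := is_deriveM (is_derive_binomial_sum a x1) (is_derive_powR_onem (- a) xlt1).
  rewrite -[binomial_sum a * _]/g; congr (is_derive _ _ _ _).
  rewrite /GRing.scale/= -(binomial_sumB1 a x1).
  have -> : (1 - x) `^ (- a) = (1 - x) * (1 - x) `^ (- a - 1).
    by rewrite mulr_powRB1_gt0.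
  ring.
move=> w1; have w1' : w < 1 by rewrite (le_lt_trans (ler_norm _)).
have sub x y : `|x| < 1 -> `|y| < 1 -> forall z, x <= z <= y -> `|z| < 1.
  by move=> + + z; rewrite !ltr_norml => /andP[? ?] /andP[? ?] /andP[? ?]; apply/andP; split; lra.
have gcst x y : x <= y -> `|x| < 1 -> `|y| < 1 -> g y = g x.
  move=> xy x1 y1.
  have [z zxy||c _] := @MVT_segment R g (cst 0) x y xy.
  - by apply: dg; apply: (sub x y) => //; rewrite !(itvP zxy).
  - apply: derivable_within_continuous => z zxy.
    have /dg[//] : `|z| < 1 by apply: (sub x y) => //; rewrite !(itvP zxy).
  by move=> /eqP; rewrite mul0r subr_eq0 => /eqP.
have g0 : g 0 = 1.
  rewrite /g subr0 powR1 mulr1 /binomial_sum; apply/cvg_lim => //.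
  rewrite -cvg_shiftS; apply: (eq_cvgn (f := cst 1)) => [n|]; last exact: cvg_cst.
  by rewrite /= pseriesS mul0r addr0 binomial_coef0.
have : g w = 1.
  have [w0|/ltW w0] := leP 0 w; first by rewrite -g0; apply: gcst => //; rewrite normr0.
  by rewrite -g0; apply/esym; apply: gcst => //; rewrite normr0.
by rewrite /g powRN => /divr1_eq.
Qed.

Lemma cvg_binomial a w : `|w| < 1 ->
  pseries (binomial_coef a) w @ \oo --> (1 - w) `^ a.
Proof. by move=> w1; rewrite -binomial_sumE//; exact: cvg_binomial_sum. Qed.

End Binomial.

(** * Euler's integral and its expansion around any point below 1 *)

Section EulerIntegral.
Context {R : realType}.
Local Notation mu := (@lebesgue_measure R).
Implicit Types (p q x z M : R) (g : R -> R).

(** A power is monotone on [a, b], so one endpoint value bounds it; the sum serves both signs of the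
    exponent at once. *)
Lemma powR_le_add p (a b y : R) : 0 < a -> a <= y <= b -> y `^ p <= a `^ p + b `^ p.
Proof.
move=> a0 /andP[ay yb]; have y0 : 0 < y by rewrite (lt_le_trans a0).
have [p0|p0] := leP 0 p.
  by rewrite ler_wpDl ?powR_ge0// ge0_ler_powR ?nnegrE// ltW// (lt_le_trans y0).
rewrite ler_wpDr ?powR_ge0// -[p]opprK !(powRN _ (- p)) lef_pV2 ?posrE ?powR_gt0//.
by rewrite ge0_ler_powR ?nnegrE ?oppr_ge0 ?(ltW a0) ?(ltW y0) ?(ltW p0).
Qed.

Lemma integrable_powR01 p : -1 < p ->
  mu.-integrable `]0, 1[ (EFin \o (fun x => x `^ p)).
Proof.
move=> p1; apply/integrableP; split.
  by apply/measurable_EFinP; apply: measurable_funTS; exact: measurable_powR.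
under eq_integral do rewrite /= ger0_norm ?powR_ge0//.
by rewrite integral_powR_oo// ltry.
Qed.

Lemma integrable_powR01M p g M : -1 < p -> measurable_fun setT g ->
  (forall x, 0 < x < 1 -> `|g x| <= M) ->
  mu.-integrable `]0, 1[ (EFin \o (fun x => x `^ p * g x)).
Proof.
move=> p1 mg gM.
apply: (@le_integrable _ (measurableTypeR R) R mu _ _ _ (fun x => M%:E * (x `^ p)%:E)%E) => //.
- apply/measurable_EFinP; apply: measurable_funTS; exact: measurable_funM.
- move=> x /=; rewrite in_itv/= => x01; rewrite lee_fin !normrM mulrC.
  by rewrite ler_wpM2r// (le_trans (gM _ x01))// ler_norm.
- exact: integrableZl (integrable_powR01 p1).
Qed.

(** For p > -1 and |z| < 1 this is 2F1(-q, p+1; p+2; z) / (p+1). It is used with [p = h] and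
    [q = h - 1]. *)
Definition euler_integral p q z : R :=
  \int[mu]_(x in `]0, 1[) (x `^ p * (1 - z * x) `^ q).

Lemma measurable_powR_affine q z : measurable_fun setT (fun x => (1 - z * x) `^ q).
Proof.
apply: (measurableT_comp (measurable_powR q)); exact: measurable_funB.
Qed.

Section expansion.
Variables (p q z0 : R).
Hypotheses (p_gtN1 : -1 < p) (z0_lt1 : z0 < 1).
(** [m] and [M] enclose 1 - z0 x for 0 < x < 1, whatever the sign of [z0]; [m] is also the radius
    within which the expansion at [z0] is proved. *)
Let m : R := Num.min 1 (1 - z0).
Let M : R := Num.max 1 (1 - z0).

Let m_gt0 : 0 < m. Proof. by rewrite lt_min ltr01 subr_gt0. Qed.

Let base x : 0 < x < 1 -> m <= 1 - z0 * x <= M.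
Proof.
move=> /andP[x0 x1]; have [z00|z00] := leP 0 z0.
  apply/andP; split.
    by rewrite ge_min; apply/orP; right; rewrite lerD2l lerN2 ler_piMr// ltW.
  by rewrite le_max; apply/orP; left; rewrite gerBl mulr_ge0// ltW.
apply/andP; split.
  by rewrite ge_min; apply/orP; left; rewrite lerBrDr gerDl nmulr_rle0// ltW.
by rewrite le_max; apply/orP; right; rewrite lerD2l lerN2 -[leLHS]mulr1 ler_nM2l// ltW.
Qed.

(** From 1 - z x = (1 - z0 x) (1 - w) with w = (z - z0) x / (1 - z0 x): expand (1 - w)^q and collect
    the factor of (z - z0)^n. *)
Definition euler_coef n : R := binomial_coef q n *
  \int[mu]_(x in `]0, 1[) (x `^ p * ((1 - z0 * x) `^ (q - n%:R) * x ^+ n)).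

Let term_bound n : exists C : R, forall x, 0 < x < 1 ->
  `|(1 - z0 * x) `^ (q - n%:R) * x ^+ n| <= C.
Proof.
exists (m `^ (q - n%:R) + M `^ (q - n%:R)) => x x01.
have [x0 x1] := andP x01; rewrite ger0_norm ?mulr_ge0 ?powR_ge0 ?exprn_ge0 ?(ltW x0)//.
rewrite (@le_trans _ _ ((1 - z0 * x) `^ (q - n%:R)))//.
  by rewrite ler_piMr ?powR_ge0// exprn_ile1// ltW.
by rewrite powR_le_add// base.
Qed.

Let mterm n : measurable_fun setT (fun x => (1 - z0 * x) `^ (q - n%:R) * x ^+ n).
Proof. by apply: measurable_funM => //; exact: measurable_powR_affine. Qed.

Let iterm n : mu.-integrable `]0, 1[
  (EFin \o (fun x => x `^ p * ((1 - z0 * x) `^ (q - n%:R) * x ^+ n))).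
Proof.
by have [C HC] := term_bound n; exact: (integrable_powR01M p_gtN1 (mterm n) HC).
Qed.

Lemma integrable_euler_integrand :
  mu.-integrable `]0, 1[ (EFin \o (fun x => x `^ p * (1 - z0 * x) `^ q)).
Proof.
apply: eq_integrable (iterm 0) => //= x _.
by rewrite subr0 mulr1.
Qed.

Let partial y n x : R := \sum_(0 <= k < n) binomial_coef q k * y ^+ k *
    (x `^ p * ((1 - z0 * x) `^ (q - k%:R) * x ^+ k)).

Let partial_int y n : mu.-integrable `]0, 1[ (EFin \o partial y n) /\
  (\int[mu]_(x in `]0%R, 1%R[) (partial y n x)%:E = (pseries euler_coef y n)%:E)%E.
Proof.
elim: n => [|n [IH1 IH2]].
  have p0 x : partial y 0 x = 0 by rewrite /partial big_geq.
  split.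
    rewrite (_ : _ \o _ = cst 0%E); first exact: integrable0.
    by apply/funext => x /=; rewrite p0.
  rewrite /pseries /series/= big_geq//; apply: integral0_eq => x _.
  by rewrite p0.
pose t x : R := binomial_coef q n * y ^+ n *
    (x `^ p * ((1 - z0 * x) `^ (q - n%:R) * x ^+ n)).
have step : EFin \o partial y n.+1 = ((EFin \o partial y n) \+ (EFin \o t))%E.
  by apply/funext => x; rewrite /partial /= big_nat_recr.
have it : mu.-integrable `]0, 1[ (EFin \o t).
  exact: (integrableZl _ (binomial_coef q n * y ^+ n) (iterm n)).
split; first by rewrite step; exact: integrableD.
transitivity (\int[mu]_(x in `]0%R, 1%R[) ((EFin \o partial y n) \+ (EFin \o t)) x)%E.
  by rewrite -step.
rewrite integralD_EFin// IH2.
have -> : pseries euler_coef y n.+1 = pseries euler_coef y n + euler_coef n * y ^+ n.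
  by rewrite /pseries /series/= big_nat_recr.
rewrite EFinD; congr (_ + _)%E.
rewrite /t; under eq_integral do rewrite /= EFinM.
rewrite (integralZl _ (iterm n))// /euler_coef /Rintegral.
by rewrite [in RHS]mulrAC [RHS]EFinM fineK// (integrable_fin_num _ (iterm n)).
Qed.

(** Dominated convergence for the partial sums of the binomial series in w. As |w| <= [rho] < 1
    uniformly in x, these sums are bounded by [K], and (1 - z0 x)^q by [C], which leaves the
    integrable majorant C K x^p. *)
Lemma cvg_euler_integral z : `|z - z0| < m ->
  pseries euler_coef (z - z0) @ \oo --> euler_integral p q z.
Proof.
move=> zm; pose y := z - z0.
have M_gt0 : 0 < M by rewrite lt_max ltr01.
pose rho := `|y| / m.
have rho01 : 0 <= rho < 1 by rewrite divr_ge0 ?(ltW m_gt0)//= ltr_pdivrMr// mul1r.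
pose K := limn (series (fun n => `|binomial_coef q n| * rho ^+ n)).
have HK n : series (fun n => `|binomial_coef q n| * rho ^+ n) n <= K.
  apply: nondecreasing_cvgn_le; last exact: binomial_cvg_norm.
  by apply: nondecreasing_series => k _ _; rewrite mulr_ge0// exprn_ge0//; case/andP: rho01.
pose C := m `^ q + M `^ q.
pose w x := y * x / (1 - z0 * x).
have bpos x : 0 < x < 1 -> 0 < 1 - z0 * x by move=> /base/andP[/(lt_le_trans m_gt0)].
have partialE n x : 0 < x < 1 ->
    partial y n x = x `^ p * (1 - z0 * x) `^ q * pseries (binomial_coef q) (w x) n.
  move=> x01; rewrite /partial /pseries /series/= mulr_sumr; apply: eq_bigr => k _.
  have b0 := bpos _ x01.
  rewrite powRB ?(gt_eqF b0) ?implybT// powR_mulrn ?ltW// /w exprMn exprMn exprVn; ring.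
have wrho x : 0 < x < 1 -> `|w x| <= rho.
  move=> x01; have b0 := bpos _ x01; have /andP[x0 x1] := x01.
  rewrite /w /rho normrM normfV [`|1 - _|]gtr0_norm// normrM.
  rewrite ler_pM ?mulr_ge0 ?invr_ge0 ?(ltW b0)//.
    by rewrite ler_piMr// gtr0_norm// ltW.
  by rewrite lef_pV2 ?posrE//; case/andP: (base x01).
have onem_w x : 0 < x < 1 -> 1 - z * x = (1 - z0 * x) * (1 - w x).
  move=> x01; have b0 := bpos _ x01; rewrite /w /y; field; exact: lt0r_neq0.
have mpart n : measurable_fun (`]0, 1[%classic : set R) (fun x : R => (partial y n x)%:E).
  by have [/(measurable_int mu)] := partial_int y n.
have [] := @dominated_convergence _ (measurableTypeR R) R mu `]0%R, 1%R[%classic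
  (measurable_itv _) (fun n x => (partial y n x)%:E)
  (fun x => (x `^ p * (1 - z * x) `^ q)%:E) (fun x => (C * K)%:E * (x `^ p)%:E)%E mpart.
- apply/measurable_EFinP; apply: measurable_funTS; apply: measurable_funM => //.
  exact: measurable_powR_affine.
- apply: aeW => x; rewrite /= in_itv/= => x01.
  under eq_fun do rewrite partialE//.
  apply: cvg_EFin; first exact: nearW.
  have b0 := bpos _ x01.
  rewrite onem_w// powRM ?(ltW b0)//; last first.
    by rewrite subr_ge0 (le_trans (ler_norm _))// (le_trans (wrho _ x01))// ltW//; case/andP: rho01.
  rewrite mulrA; apply: cvgMr; apply: cvg_binomial.
  by rewrite (le_lt_trans (wrho _ x01))//; case/andP: rho01.
- exact: integrableZl (integrable_powR01 p_gtN1).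
- apply: aeW => x n; rewrite /= in_itv/= => x01; rewrite lee_fin partialE//.
  rewrite !normrM (ger0_norm (powR_ge0 _ _)) (ger0_norm (powR_ge0 _ _)).
  rewrite -mulrA mulrC ler_wpM2r ?powR_ge0// ler_pM ?powR_ge0//.
    by rewrite powR_le_add// base.
  rewrite (le_trans _ (HK n))// /pseries /series/= (le_trans (ler_norm_sum _ _ _))//.
  apply: ler_sum => k _; rewrite normrM ler_wpM2l// normrX lerXn2r ?nnegrE ?wrho//.
  by case/andP: rho01.
move=> ilim _.
rewrite [X in X @ \oo --> _ -> _](_ : _ = fun n => (pseries euler_coef y n)%:E); last first.
  by apply/funext => n; exact: (partial_int y n).2.
rewrite -[X in _ --> X]fineK; last exact: (integrable_fin_num _ ilim).
by move/fine_cvgP => [_].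
Qed.
End expansion.
End EulerIntegral.

(** * Closed form of the hypergeometric function *)

Section GaussFunction.
Context {R : realType}.
Local Notation mu := (@lebesgue_measure R).
Implicit Types (h z : R).

Lemma euler_coef0 (p q : R) n : -1 < p ->
  euler_coef p q 0 n = binomial_coef q n / (p + n%:R + 1).
Proof.
move=> p1; rewrite /euler_coef; congr (_ * _).
transitivity (\int[mu]_(x in `]0, 1[) (x `^ (p + n%:R))).
  apply: eq_Rintegral => x; rewrite inE/= in_itv/= => /andP[x0 _].
  by rewrite mul0r subr0 powR1 mul1r powRD_gt0// powR_mulrn ?ltW.
rewrite /Rintegral integral_powR_oo//= ?powR1 ?div1r//.
by rewrite ltr_wpDr.
Qed.

Definition gauss_closed h z : R := (1 - z) `^ h + h * (z * euler_integral h (h - 1) z).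

(** For n >= 1, (h)_n / (h+1)_n = h/(h+n) = 1 - n/(h+n). The 1 gives the binomial series, and n
    c_n(h) = -h c_(n-1)(h-1) turns the rest into the coefficients of z times the Euler integral. *)
Lemma hyp2F1_coefE h n : -1 < h ->
  hyp2F1_coef (- h) h (h + 1) n =
  binomial_coef h n + h * shift_coef (euler_coef h (h - 1) 0) n.
Proof.
move=> h1; have h1' : 0 < h + 1 by rewrite -ltrBlDr sub0r.
case: n => [|n].
  by rewrite /hyp2F1_coef binomial_coef0 !rising0 mulr0 addr0 fact0 !mul1r invr1.
rewrite /shift_coef euler_coef0//.
have hn : 0 < h + n%:R + 1 by rewrite addrAC ltr_wpDr.
have -> : h * (binomial_coef (h - 1) n / (h + n%:R + 1)) =
    - n.+1%:R * binomial_coef h n.+1 / (h + n%:R + 1).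
  by rewrite !mulNr binomial_coefB1 !mulNr opprK mulrA.
rewrite /hyp2F1_coef /binomial_coef (risingSl h) (risingS (h + 1)) -natr1.
have := lt0r_neq0 (rising_gt0 n h1').
have : (n.+1)`!%:R != 0 :> R by rewrite pnatr_eq0 -lt0n fact_gt0.
move: (rising (- h) n.+1) (rising (h + 1) n) (n.+1)`!%:R => r1 r2 f f0 r20.
have hn' : 0 < h + 1 + n%:R by rewrite addrAC.
by field; rewrite f0 r20 !gt_eqF.
Qed.

Lemma cvg_gauss h z : -1 < h -> `|z| < 1 ->
  pseries (hyp2F1_coef (- h) h (h + 1)) z @ \oo --> gauss_closed h z.
Proof.
move=> h1 z1; apply: (@eq_cvgn _ (pseries (fun n => binomial_coef h n +
    h * shift_coef (euler_coef h (h - 1) 0) n) z)) => [n|].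
  by congr (pseries _ _ n); apply/funext => k; rewrite hyp2F1_coefE.
apply: cvg_pseriesD; first exact: cvg_binomial.
apply: cvg_pseriesZ; apply: cvg_pseries_shift.
by have := @cvg_euler_integral R h (h - 1) 0 h1 ltr01 z; rewrite !subr0 minxx; apply.
Qed.

Lemma pseries_scale (u : R^nat) (y d : R) n :
  pseries (fun k => u k / d ^+ k) y n = pseries u (y / d) n.
Proof.
by rewrite /pseries /series/=; apply: eq_bigr => k _; rewrite exprMn exprVn mulrA mulrAC.
Qed.

(** The power (1-z)^h is expanded after factoring out (1-z0)^h. The factor z of the integral is
    written z0 + (z - z0), whose second summand shifts the coefficients by one. *)
Lemma analytic_gauss h z0 : -1 < h -> z0 < 1 -> analytic_at (gauss_closed h) z0.
Proof.
move=> h1 z01; have d0 : 0 < 1 - z0 by rewrite subr_gt0.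
pose e := euler_coef h (h - 1) z0.
exists (Num.min 1 (1 - z0)); first by rewrite lt_min ltr01.
exists (fun n => (1 - z0) `^ h * (binomial_coef h n / (1 - z0) ^+ n) +
  h * (z0 * e n + shift_coef e n)) => z zr.
have H := @cvg_euler_integral R h (h - 1) z0 h1 z01 z zr.
have zd : `|z - z0| < 1 - z0 by move: zr; rewrite lt_min => /andP[].
rewrite /gauss_closed.
have -> : (1 - z) `^ h = (1 - z0) `^ h * (1 - (z - z0) / (1 - z0)) `^ h.
  have wd : (z - z0) / (1 - z0) <= 1.
    by rewrite ler_pdivrMr// mul1r (le_trans (ler_norm _))// ltW.
  rewrite -powRM ?(ltW d0) ?subr_ge0//; congr (_ `^ _).
  by field; rewrite gt_eqF.
rewrite [z * _](_ : _ = z0 * euler_integral h (h - 1) z +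
  (z - z0) * euler_integral h (h - 1) z); last by ring.
apply: cvg_pseriesD.
  apply: cvg_pseriesZ; apply: (@eq_cvgn _ (pseries (binomial_coef h) ((z - z0) / (1 - z0)))).
    by move=> n; rewrite pseries_scale.
  apply: cvg_binomial.
  by rewrite normrM normfV (gtr0_norm d0) ltr_pdivrMr// mul1r.
apply: cvg_pseriesZ; apply: cvg_pseriesD; last exact: cvg_pseries_shift.
exact: cvg_pseriesZ.
Qed.

(** If the choice succeeds, the chosen function and [gauss_closed] both sum the Gauss series on ]0,
    1[, and the identity theorem extends the equality to ]-oo, 1[. It cannot fail, [gauss_closed]
    being a candidate. *)
Lemma hyp2F1E h z : -1 < h -> z < 1 -> hyp2F1 (- h) h (h + 1) z = gauss_closed h z.
Proof.
move=> h1; rewrite /hyp2F1; case: xgetP => [f _ [fs fa]|/(_ (gauss_closed h))]; last first.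
  by case; split => [x|x]; [exact: cvg_gauss|exact: analytic_gauss].
apply: (@analytic_identity _ f (gauss_closed h) 0) => //.
  by move=> x x1; exact: analytic_gauss.
move=> x /andP[x0 x1]; have x1' : `|x| < 1 by rewrite gtr0_norm.
exact: (cvg_unique _ (fs _ x1') (cvg_gauss h1 x1')).
Qed.

End GaussFunction.

(** * The kernel in closed form and the moments of its two pieces *)

Section Kernel.
Context {R : realType}.
Local Notation mu := (@lebesgue_measure R).
Implicit Types (h s t v z : R) (k : nat).

Definition tail_integrand h s v : R := (v - s) `^ h * v `^ (h - 1).

Lemma tail_integrand_ge0 h s v : 0 <= tail_integrand h s v.
Proof. by rewrite mulr_ge0 ?powR_ge0. Qed.

Lemma measurable_tail_integrand d (T : measurableType d) h (f g : T -> R) :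
  measurable_fun setT f -> measurable_fun setT g ->
  measurable_fun setT (fun x => tail_integrand h (f x) (g x)).
Proof.
move=> mf mg; apply: measurable_funM.
  by apply: (measurableT_comp (measurable_powR _)); apply: measurable_funB.
exact: (measurableT_comp (measurable_powR _)).
Qed.

Definition tail_kernel h t s : \bar R :=
  (\int[mu]_(v in `]s, t[) (tail_integrand h s v)%:E)%E.

Lemma tail_kernel_ge0 h t s : (0 <= tail_kernel h t s)%E.
Proof. by apply: integral_ge0 => v _; rewrite lee_fin tail_integrand_ge0. Qed.

Lemma tail_kernelE h t s : -1 < h -> 0 < s < t ->
  tail_kernel h t s =
  ((t - s) `^ (h + 1) * s `^ (h - 1) * euler_integral h (h - 1) (1 - t / s))%:E.
Proof.
move=> h1 /andP[s0 st]; have ts0 : 0 < t - s by rewrite subr_gt0.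
have z1 : 1 - t / s < 1 by rewrite gtrBl divr_gt0// (lt_trans s0).
rewrite EFinM /euler_integral /Rintegral fineK; last first.
  exact: (integrable_fin_num _ (integrable_euler_integrand _ h1 z1)).
have mf : measurable_fun setT (fun v => if v \in `]s, t[ then (tail_integrand h s v)%:E else 0%E).
  apply: measurable_fun_ifT => //.
    by under eq_fun do rewrite in_itv/=; apply: measurable_lt2.
  by apply/measurable_EFinP; exact: measurable_tail_integrand.
rewrite /tail_kernel integral_itv_if (@ge0_integral_affine _ (t - s) s)//; last first.
  by move=> v; case: ifP => // _; rewrite lee_fin tail_integrand_ge0.
rewrite (powRD_gt0 h 1 ts0) powRr1 ?(ltW ts0)// [_ * (t - s)]mulrC -mulrA EFinM -muleA.
congr (_ * _)%E; rewrite -ge0_integralZl//; last 3 first.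
- apply/measurable_EFinP; apply: measurable_funTS; apply: measurable_funM => //.
  exact: measurable_powR_affine.
- by move=> x _; rewrite lee_fin mulr_ge0 ?powR_ge0.
- by rewrite lee_fin mulr_ge0 ?powR_ge0.
rewrite [RHS]integral_itv_if; apply: eq_integral => x _.
have -> : ((t - s) * x + s \in `]s, t[) = (x \in `]0, 1[).
  rewrite !in_itv/= ltrDr pmulr_rgt0//; congr (_ && _).
  by rewrite -ltrBrDr gtr_pMr.
case: ifPn => //; rewrite in_itv/= => /andP[x0 x1].
rewrite -EFinM; congr EFin; rewrite /tail_integrand addrK.
(* This exhibits v as s times the base of Euler's integral at z = 1 - t/s. *)
have -> : (t - s) * x + s = s * (1 - (1 - t / s) * x) by field; rewrite gt_eqF.
rewrite !powRM ?(ltW s0) ?(ltW ts0) ?(ltW x0)//; first by ring.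
rewrite subr_ge0 (le_trans _ (ltW x1))// ler_piMl// ?(ltW z1)// ltW//.
Qed.

(** With z = 1 - t/s one has (1-z)^h = t^h s^(-h) and h z = -h (t-s)/s; the latter is the origin of
    the minus sign. *)
Lemma gauss_kernelE h t s : -1 < h -> 0 < s < t ->
  (t - s) `^ h * hyp2F1 (- h) h (h + 1) (1 - t / s) =
  s `^ (- h) * (t `^ h * (t - s) `^ h) - h * (s `^ (- h) * fine (tail_kernel h t s)).
Proof.
move=> h1 st; rewrite tail_kernelE//=; have /andP[s0 ts] := st.
have ts0 : 0 < t - s by rewrite subr_gt0.
have t0 : 0 < t by rewrite (lt_trans s0).
rewrite hyp2F1E//; last by rewrite gtrBl divr_gt0.
rewrite /gauss_closed subKr powRM ?invr_ge0 ?(ltW t0) ?(ltW s0)//.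
have -> : s^-1 `^ h = s `^ (- h) by rewrite powRN -powR_inv1 ?(ltW s0)// -powRrM mulN1r powRN.
rewrite (powRD_gt0 h 1 ts0) powRr1 ?(ltW ts0)//.
have -> : s `^ (- h) = (s * s `^ (h - 1))^-1 by rewrite powRN mulr_powRB1_gt0.
have sh0 : s `^ (h - 1) != 0 by rewrite gt_eqF// powR_gt0.
by field; rewrite sh0 gt_eqF.
Qed.

Definition beta_coef h k : R := Gamma (k%:R - h + 1) * Gamma (h + 1) / Gamma (2 + k%:R).

Lemma beta_coef_ge0 h k : -1 < h < 1 -> 0 <= beta_coef h k.
Proof.
move=> /andP[h1 h2]; have k0 : 0 <= k%:R :> R by [].
have g1 : 0 < Gamma (k%:R - h + 1) by apply: Gamma_gt0; lra.
have g2 : 0 < Gamma (h + 1) by apply: Gamma_gt0; lra.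
have g3 : 0 < Gamma (2 + k%:R : R) by apply: Gamma_gt0; lra.
by rewrite ltW// divr_gt0// mulr_gt0.
Qed.

Lemma head_moment h k t : -1 < h < 1 -> 0 < t ->
  (\int[mu]_(s in `]0%R, t[) (s `^ (k%:R - h) * (t - s) `^ h)%:E =
   (beta_coef h k * t `^ (1 + k%:R))%:E)%E.
Proof.
move=> /andP[h1 h2] t0.
have a0 : 0 < k%:R - h + 1 by have : 0 <= k%:R :> R by []; lra.
have b0 : 0 < h + 1 by rewrite -ltrBlDr sub0r.
have := convolution_integralE a0 b0 t0.
rewrite (_ : k%:R - h + 1 + (h + 1) = 2 + k%:R); last by ring.
rewrite (_ : 2 + k%:R - 1 = 1 + k%:R); last by ring.
by under eq_integral do rewrite /convolution_integrand !addrK.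
Qed.

(** On 0 < s < v < t, integrating in s first is [head_moment] with v in place of t. A multiple of
    v^(h+k) remains, whose integral brings the factor 1/(h+k+1). *)
Lemma tail_moment h k t : -1 < h < 1 -> 0 < t ->
  (\int[mu]_(s in `]0%R, t[) ((s `^ (k%:R - h))%:E * tail_kernel h t s) =
   (beta_coef h k / (h + k%:R + 1) * t `^ (h + k%:R + 1))%:E)%E.
Proof.
move=> h12 t0; have /andP[h1 h2] := h12.
pose f (z : R * R) : \bar R := (if (0 < z.1 < z.2) && (z.2 < t) then
   z.1 `^ (k%:R - h) * tail_integrand h z.1 z.2 else 0)%:E.
have mf : measurable_fun setT f.
  apply/measurable_EFinP; apply: measurable_fun_ifT => //.
    by apply: measurable_and; [exact: measurable_lt2|exact: measurable_fun_ltr].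
  apply: measurable_funM; last exact: measurable_tail_integrand.
  exact: (measurableT_comp (measurable_powR _)).
have f0 y : (0 <= f y)%E.
  by rewrite lee_fin; case: ifP => // _; rewrite mulr_ge0 ?powR_ge0 ?tail_integrand_ge0.
transitivity (\int[mu]_s \int[mu]_v f (s, v))%E.
  rewrite integral_itv_if; apply: eq_integral => s _; rewrite in_itv/=.
  case: ifPn => [/andP[s0 st]|s0t]; last first.
    rewrite integral0_eq// => v _; rewrite /f/=; case: ifPn => // /andP[/andP[s0 sv] vt].
    by rewrite s0 (lt_trans sv vt) in s0t.
  rewrite /tail_kernel -ge0_integralZl//; last 3 first.
  - by apply/measurable_EFinP; apply: measurable_funTS; exact: measurable_tail_integrand.
  - by move=> v _; rewrite lee_fin tail_integrand_ge0.
  - by rewrite lee_fin powR_ge0.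
  rewrite integral_itv_if; apply: eq_integral => v _; rewrite in_itv/= /f/= s0/=.
  by case: ifP.
rewrite (@fubini_tonelli _ _ _ _ _ mu mu f mf f0).
transitivity (\int[mu]_(v in `]0%R, t[) ((beta_coef h k)%:E * (v `^ (h + k%:R))%:E))%E.
  rewrite [RHS]integral_itv_if; apply: eq_integral => v _; rewrite in_itv/=.
  case: ifPn => [/andP[v0 vt]|v0t]; last first.
    rewrite integral0_eq// => s _; rewrite /f/=; case: ifPn => // /andP[/andP[s0 sv] vt].
    by rewrite (lt_trans s0 sv) vt in v0t.
  rewrite -EFinM (_ : beta_coef h k * _ = v `^ (h - 1) * (beta_coef h k * v `^ (1 + k%:R))); last first.
    rewrite mulrCA -powRD_gt0//; congr (_ * _ `^ _); ring.
  rewrite EFinM -head_moment// -ge0_integralZl//; last 3 first.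
  - apply/measurable_EFinP; apply: measurable_funTS; apply: measurable_funM => //.
    by apply: (measurableT_comp (measurable_powR _)); apply: measurable_funB.
  - by move=> s _; rewrite lee_fin mulr_ge0 ?powR_ge0.
  - by rewrite lee_fin powR_ge0.
  rewrite [RHS]integral_itv_if; apply: eq_integral => s _; rewrite in_itv/= /f/= vt andbT.
  by case: ifP => // _; rewrite -EFinM /tail_integrand; congr EFin; ring.
have hk : -1 < h + k%:R by rewrite ltr_wpDr.
rewrite ge0_integralZl//; last 3 first.
- by apply/measurable_EFinP; apply: measurable_funTS.
- by move=> v _; rewrite lee_fin powR_ge0.
- by rewrite lee_fin beta_coef_ge0.
by rewrite integral_powR_oo// -EFinM mulrA [in RHS]mulrAC.
Qed.

End Kernel.

(** * Splitting and measurability of the fractional kernel *)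

Section FractionalKernel.
Context {R : realType}.
Local Notation mu := (@lebesgue_measure R).
Implicit Types (H h s t T : R) (k : nat).

Definition kernel_head h t s : R :=
  if 0 < s < t then s `^ (- h) * (t `^ h * (t - s) `^ h) else 0.

Definition kernel_tail h t s : R :=
  if 0 < s < t then s `^ (- h) * fine (tail_kernel h t s) else 0.

Lemma kernel_head_ge0 h t s : 0 <= kernel_head h t s.
Proof. by rewrite /kernel_head; case: ifP => // _; rewrite !mulr_ge0 ?powR_ge0. Qed.

Lemma kernel_tail_ge0 h t s : 0 <= kernel_tail h t s.
Proof.
rewrite /kernel_tail; case: ifP => // _.
by rewrite mulr_ge0 ?powR_ge0 ?fine_ge0 ?tail_kernel_ge0.
Qed.

Lemma fbm_kernelE H t s : 0 < H < 1 ->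
  fbm_kernel H t s = fbm_const H / Gamma (H + 1 / 2) *
    (kernel_head (H - 1 / 2) t s - (H - 1 / 2) * kernel_tail (H - 1 / 2) t s).
Proof.
move=> /andP[H0 H1]; rewrite /fbm_kernel /kernel_head /kernel_tail.
case: ifP => [st|_]; last by rewrite mulr0 subr0 mulr0.
have -> : 1 / 2 - H = - (H - 1 / 2) by rewrite opprB.
have -> : hyp2F1 (- (H - 1 / 2)) (H - 1 / 2) (H + 1 / 2) =
          hyp2F1 (- (H - 1 / 2)) (H - 1 / 2) (H - 1 / 2 + 1) by congr hyp2F1; field.
by rewrite -[LHS]mulrA gauss_kernelE//; lra.
Qed.

Lemma measurable_kernel_head h :
  measurable_fun setT (fun z : R * R => kernel_head h z.1 z.2).
Proof.
apply: measurable_fun_ifT => //; first exact: measurable_lt2.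
apply: measurable_funM; first exact: (measurableT_comp (measurable_powR _)).
apply: measurable_funM; first exact: (measurableT_comp (measurable_powR _)).
by apply: (measurableT_comp (measurable_powR _)); exact: measurable_funB.
Qed.

Lemma measurable_tail_kernel h :
  measurable_fun setT (fun z : R * R => tail_kernel h z.1 z.2).
Proof.
pose f (y : (R * R) * R) : \bar R :=
  (if y.1.2 < y.2 < y.1.1 then tail_integrand h y.1.2 y.2 else 0)%:E.
have mf : measurable_fun setT f.
  have m1 : measurable_fun setT (fun y : (R * R) * R => y.1.1) by exact: measurableT_comp.
  have m2 : measurable_fun setT (fun y : (R * R) * R => y.1.2) by exact: measurableT_comp.
  apply/measurable_EFinP; apply: measurable_fun_ifT => //; first exact: measurable_lt2.
  exact: measurable_tail_integrand.
have f0 y : (0 <= f y)%E.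
  by rewrite lee_fin; case: ifP => // _; exact: tail_integrand_ge0.
have := @measurable_fun_fubini_tonelli_F _ _ _ _ R mu f mf f0.
rewrite (_ : fubini_F _ _ = fun z => tail_kernel h z.1 z.2)//.
apply/funext => z; rewrite /fubini_F /tail_kernel integral_itv_if.
by apply: eq_integral => v _; rewrite /f/= in_itv/=; case: ifP.
Qed.

Lemma measurable_kernel_tail h :
  measurable_fun setT (fun z : R * R => kernel_tail h z.1 z.2).
Proof.
apply: measurable_fun_ifT => //; first exact: measurable_lt2.
apply: measurable_funM; first exact: (measurableT_comp (measurable_powR _)).
by apply: measurableT_comp; [exact: fine_measurable|exact: measurable_tail_kernel].
Qed.

(** [hyp2F1] is obtained by choice, so joint measurability is reached through the closed form, whose
    integral term is measurable by Tonelli. *)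
Lemma measurable_fbm_kernel H : 0 < H < 1 ->
  measurable_fun setT (fun z : R * R => fbm_kernel H z.1 z.2).
Proof.
move=> H01; under eq_fun do rewrite fbm_kernelE//.
apply: measurable_funM => //; apply: measurable_funB; first exact: measurable_kernel_head.
by apply: measurable_funM => //; exact: measurable_kernel_tail.
Qed.

Lemma tail_kernel_fin_num h t s : -1 < h -> 0 < s < t -> tail_kernel h t s \is a fin_num.
Proof. by move=> h1 st; rewrite tail_kernelE. Qed.

Lemma integral_kernel_head h k t : -1 < h < 1 -> 0 < t ->
  (\int[mu]_(s in `]0%R, t[) (s ^+ k * kernel_head h t s)%:E =
   (beta_coef h k * t `^ (h + k%:R + 1))%:E)%E.
Proof.
move=> h12 t0.
have -> : beta_coef h k * t `^ (h + k%:R + 1) = t `^ h * (beta_coef h k * t `^ (1 + k%:R)).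
  by rewrite mulrCA -powRD_gt0//; congr (_ * _ `^ _); ring.
rewrite EFinM -head_moment// -ge0_integralZl//; last 3 first.
- apply/measurable_EFinP; apply: measurable_funTS; apply: measurable_funM => //.
  by apply: (measurableT_comp (measurable_powR _)); apply: measurable_funB.
- by move=> s _; rewrite lee_fin mulr_ge0 ?powR_ge0.
- by rewrite lee_fin powR_ge0.
apply: eq_integral => s; rewrite inE/= in_itv/= => st.
rewrite /kernel_head st -EFinM; congr EFin; have /andP[s0 _] := st.
rewrite powRB ?(gt_eqF s0) ?implybT// powR_mulrn ?(ltW s0)// powRN; ring.
Qed.

Lemma integral_kernel_tail h k t : -1 < h < 1 -> 0 < t ->
  (\int[mu]_(s in `]0%R, t[) (s ^+ k * kernel_tail h t s)%:E =
   (beta_coef h k / (h + k%:R + 1) * t `^ (h + k%:R + 1))%:E)%E.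
Proof.
move=> h12 t0; rewrite -tail_moment//.
apply: eq_integral => s; rewrite inE/= in_itv/= => st.
have /andP[s0 _] := st; have /andP[h1 _] := h12.
rewrite /kernel_tail st mulrA EFinM fineK ?tail_kernel_fin_num//.
by rewrite powRD_gt0// powR_mulrn ?ltW.
Qed.

End FractionalKernel.

(** * Moments of the fractional kernel *)

Section FractionalMoments.
Context {R : realType}.
Local Notation mu := (@lebesgue_measure R).
Implicit Types (H h s t T : R) (k : nat).

(** A real value of the integral is finiteness; this is how the explicit moments yield
    integrability. *)
Lemma ge0_integrable d (X : measurableType d) (m : {measure set X -> \bar R})
    (D : set X) (f : X -> R) (r : R) :
  measurable_fun setT f -> (forall x, 0 <= f x) ->
  (\int[m]_(x in D) (f x)%:E = r%:E)%E -> m.-integrable D (EFin \o f).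
Proof.
move=> mf f0 fr; apply/integrableP; split.
  by apply/measurable_EFinP; exact: measurable_funTS.
by under eq_integral do rewrite /= ger0_norm//; rewrite fr ltry.
Qed.

(* The modulus makes the integrand nonnegative also outside [`]0, t[]. *)
Lemma integrable_kernel_head h k t : -1 < h < 1 -> 0 < t ->
  mu.-integrable `]0, t[ (EFin \o (fun s => `|s| ^+ k * kernel_head h t s)).
Proof.
move=> h12 t0.
apply: (@ge0_integrable _ _ _ _ _ (beta_coef h k * t `^ (h + k%:R + 1))).
- apply: measurable_funM.
    by apply: measurable_funX; exact: normr_measurable.
  exact: (measurableT_comp (measurable_kernel_head h) (pair1_measurable t)).
- by move=> s; rewrite mulr_ge0 ?exprn_ge0 ?kernel_head_ge0.
- rewrite -integral_kernel_head//; apply: eq_integral => s; rewrite inE/= in_itv/=.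
  by move=> /andP[s0 _]; rewrite gtr0_norm.
Qed.

Lemma integrable_kernel_tail h k t : -1 < h < 1 -> 0 < t ->
  mu.-integrable `]0, t[ (EFin \o (fun s => `|s| ^+ k * kernel_tail h t s)).
Proof.
move=> h12 t0.
apply: (@ge0_integrable _ _ _ _ _ (beta_coef h k / (h + k%:R + 1) * t `^ (h + k%:R + 1))).
- apply: measurable_funM.
    by apply: measurable_funX; exact: normr_measurable.
  exact: (measurableT_comp (measurable_kernel_tail h) (pair1_measurable t)).
- by move=> s; rewrite mulr_ge0 ?exprn_ge0 ?kernel_tail_ge0.
- rewrite -integral_kernel_tail//; apply: eq_integral => s; rewrite inE/= in_itv/=.
  by move=> /andP[s0 _]; rewrite gtr0_norm.
Qed.

Lemma measurable_fbm_kernel1 H t : 0 < H < 1 -> measurable_fun setT (fbm_kernel H t).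
Proof.
by move=> H01; exact: (measurableT_comp (measurable_fbm_kernel H01) (pair1_measurable t)).
Qed.

Definition moment_coef H k : R :=
  fbm_const H * Gamma (3 / 2 - H) * (rising (3 / 2 - H) k /
  ((H + 1 / 2 + k%:R) * k`!%:R)).

(** 1 - h/(h+k+1) = (k+1)/(h+k+1): the numerator reduces the (k+1)! of the Beta integral to k!, and
    Gamma(h+1) cancels the Gamma(H+1/2) of the kernel. *)
Lemma moment_coefE H k : 0 < H < 1 -> let h := H - 1 / 2 in
  fbm_const H / Gamma (H + 1 / 2) * (beta_coef h k - h * (beta_coef h k / (h + k%:R + 1))) =
  moment_coef H k.
Proof.
move=> /andP[H0 H1] h.
have k0 : 0 <= k%:R :> R by [].
have -> : H + 1 / 2 = h + 1 by rewrite /h; field.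
have hE : H = h + 1 / 2 by rewrite /h; field.
rewrite /moment_coef /beta_coef.
have -> : k%:R - h + 1 = 3 / 2 - H + k%:R by rewrite hE; field.
have -> : 2 + k%:R = 1 + k.+1%:R :> R by rewrite -natr1; ring.
rewrite Gamma_nat GammaD_nat; last by lra.
have g0 : Gamma (h + 1) != 0 by rewrite gt_eqF// Gamma_gt0//; rewrite /h; lra.
have f0 : k`!%:R != 0 :> R by rewrite pnatr_eq0 -lt0n fact_gt0.
have hk0 : h + k%:R + 1 != 0 by rewrite gt_eqF//; rewrite /h; lra.
have -> : H + 1 / 2 + k%:R = h + k%:R + 1 by rewrite hE; field.
rewrite factS natrM -(nat1r k); move: (k`!%:R : R) f0 => f f0.
have k10 : 1 + k%:R != 0 :> R by rewrite nat1r pnatr_eq0.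
by field; rewrite g0 f0 hk0 k10.
Qed.

Lemma fbm_kernel_moment_oo H k t : 0 < H < 1 -> 0 < t ->
  mu.-integrable `]0, t[ (EFin \o (fun s => fbm_kernel H t s * s ^+ k)) /\
  (\int[mu]_(s in `]0%R, t[) (fbm_kernel H t s * s ^+ k)%:E =
   (moment_coef H k * t `^ (H + 1 / 2 + k%:R))%:E)%E.
Proof.
move=> H01 t0; pose h := H - 1 / 2; pose c := fbm_const H / Gamma (H + 1 / 2).
have h12 : -1 < h < 1 by rewrite /h; move/andP: H01 => [? ?]; apply/andP; split; lra.
have ih := integrable_kernel_head k h12 t0; have it := integrable_kernel_tail k h12 t0.
have E s : s \in (`]0, t[%classic : set R) -> (fbm_kernel H t s * s ^+ k)%:E =
    (c%:E * ((`|s| ^+ k * kernel_head h t s)%:E - h%:E * (`|s| ^+ k * kernel_tail h t s)%:E))%E.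
  rewrite inE/= in_itv/= => /andP[s0 _].
  rewrite fbm_kernelE// gtr0_norm// -/h -/c.
  transitivity (c * (s ^+ k * kernel_head h t s - h * (s ^+ k * kernel_tail h t s)))%:E => //.
  by congr EFin; ring.
have iD : mu.-integrable `]0, t[ (fun s => (`|s| ^+ k * kernel_head h t s)%:E -
    h%:E * (`|s| ^+ k * kernel_tail h t s)%:E)%E.
  by apply: integrableB => //; exact: (integrableZl _ h it).
split; first by apply: eq_integrable (integrableZl _ c iD) => // s /E.
transitivity (\int[mu]_(s in `]0%R, t[) (c%:E * ((`|s| ^+ k * kernel_head h t s)%:E -
    h%:E * (`|s| ^+ k * kernel_tail h t s)%:E)))%E.
  by apply: eq_integral => s /E.
rewrite integralZl// integralB//; last exact: (integrableZl _ h it).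
rewrite integralZl//.
have Eabs (g : R -> R) : (\int[mu]_(s in `]0%R, t[) (`|s| ^+ k * g s)%:E =
    \int[mu]_(s in `]0%R, t[) (s ^+ k * g s)%:E)%E.
  apply: eq_integral => s; rewrite inE/= in_itv/=.
  by move=> /andP[s0 _]; rewrite gtr0_norm.
rewrite !Eabs integral_kernel_head// integral_kernel_tail//.
(* Both moments are now explicit reals, so the extended-real expression is convertible to the image
   of a real one. *)
rewrite -[LHS]/((_ * (_ - _ * _))%:E); congr EFin.
rewrite -(moment_coefE k H01) -/h -/c.
have -> : H + 1 / 2 + k%:R = h + k%:R + 1 by rewrite /h; field.
ring.
Qed.

Lemma fbm_kernel_moment H k t : 0 < H < 1 -> 0 < t ->
  mu.-integrable `[0, t] (EFin \o (fun s => fbm_kernel H t s * s ^+ k)) /\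
  \int[mu]_(s in `[0, t]) (fbm_kernel H t s * s ^+ k) =
  moment_coef H k * t `^ (H + 1 / 2 + k%:R).
Proof.
move=> H01 t0; have [int I] := fbm_kernel_moment_oo k H01 t0.
have mf : measurable_fun setT (fun s => fbm_kernel H t s * s ^+ k).
  by apply: measurable_funM => //; exact: measurable_fbm_kernel1.
split; last first.
  rewrite /Rintegral integral_itv_bndoo ?I//.
  by apply/measurable_EFinP; exact: measurable_funTS.
apply/integrableP; split; first by apply/measurable_EFinP; exact: measurable_funTS.
rewrite integral_itv_bndoo; last first.
  by apply/measurable_EFinP; apply: measurableT_comp => //; exact: measurable_funTS.
by have /integrableP[] := int.
Qed.

Lemma Rintegral_lincomb d (X : measurableType d) (m : {measure set X -> \bar R})
    (D : set X) n (c : nat -> R) (f : nat -> X -> R) : measurable D ->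
  (forall k, m.-integrable D (EFin \o f k)) ->
  m.-integrable D (EFin \o (fun x => \sum_(k < n) c k * f k x)) /\
  \int[m]_(x in D) (\sum_(k < n) c k * f k x) =
  \sum_(k < n) c k * \int[m]_(x in D) f k x.
Proof.
move=> mD intf.
have intcf k : m.-integrable D (EFin \o (fun x => c k * f k x)).
  exact: (integrableZl _ (c k) (intf k)).
elim: n => [|n [IH1 IH2]].
  have E : (fun x => \sum_(k < 0) c k * f k x) = cst 0.
    by apply/funext => x; rewrite big_ord0.
  by rewrite E big_ord0; split; [exact: integrable0|rewrite /Rintegral integral0].
have E : (fun x => \sum_(k < n.+1) c k * f k x) =
    (fun x => \sum_(k < n) c k * f k x + c n * f n x).
  by apply/funext => x; rewrite big_ord_recr.
rewrite E big_ord_recr/=; split; first exact: (integrableD _ IH1 (intcf n)).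
by rewrite RintegralD// IH2 RintegralZl.
Qed.

End FractionalMoments.

(** * Legendre polynomials and integrability over the square *)

Section FractionalMatrix.
Context {R : realType}.
Local Notation mu := (@lebesgue_measure R).
Implicit Types (H h s t T : R) (i j k : nat).

Definition legendre_norm T i : R := Num.sqrt ((2 * i%:R + 1) / T).

Lemma legendreE T i t :
  legendre T i t = \sum_(k < i.+1) legendre_norm T i * legendre_coef i k / T ^+ k * t ^+ k.
Proof.
rewrite /legendre -/(legendre_norm T i) mulr_sumr; apply: eq_bigr => k _.
by rewrite !mulrA mulrAC.
Qed.

Lemma measurable_legendre T i : measurable_fun setT (@legendre R T i).
Proof.
rewrite (_ : legendre T i = fun t => \sum_(k < i.+1)
    legendre_norm T i * legendre_coef i k / T ^+ k * t ^+ k); last first.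
  by apply/funext => t; exact: legendreE.
by apply: measurable_sum => k; apply: measurable_funM.
Qed.

Lemma legendre_bounded T i : 0 < T ->
  exists2 C : R, 0 <= C & forall t, 0 <= t <= T -> `|legendre T i t| <= C.
Proof.
move=> T0; exists (legendre_norm T i * \sum_(k < i.+1) `|legendre_coef i k|).
  by rewrite mulr_ge0 ?sqrtr_ge0// sumr_ge0.
move=> t /andP[t0 tT]; rewrite /legendre normrM ger0_norm ?sqrtr_ge0//.
rewrite ler_wpM2l ?sqrtr_ge0// (le_trans (ler_norm_sum _ _ _))// ler_sum// => k _.
rewrite normrM ler_piMr// ger0_norm ?divr_ge0 ?exprn_ge0 ?(ltW T0)//.
by rewrite ler_pdivrMr ?exprn_gt0// mul1r lerXn2r ?nnegrE// ltW.
Qed.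

Lemma fbm_kernel_legendre H T j t : 0 < H < 1 -> 0 < t ->
  mu.-integrable `[0, t] (EFin \o (fun s => fbm_kernel H t s * legendre T j s)) /\
  \int[mu]_(s in `[0, t]) (fbm_kernel H t s * legendre T j s) =
  \sum_(k < j.+1) legendre_norm T j * legendre_coef j k / T ^+ k *
    (moment_coef H k * t `^ (H + 1 / 2 + k%:R)).
Proof.
move=> H01 t0.
have E : (fun s => fbm_kernel H t s * legendre T j s) = (fun s => \sum_(k < j.+1)
    legendre_norm T j * legendre_coef j k / T ^+ k * (fbm_kernel H t s * s ^+ k)).
  by apply/funext => s; rewrite legendreE mulr_sumr; apply: eq_bigr => k _; rewrite mulrCA.
have [|I1 I2] := @Rintegral_lincomb R _ (measurableTypeR R) mu `[0, t]%classic j.+1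
   (fun k => legendre_norm T j * legendre_coef j k / T ^+ k)
   (fun k s => fbm_kernel H t s * s ^+ k) (measurable_itv _).
  by move=> k; have [] := fbm_kernel_moment k H01 t0.
rewrite E; split; first exact: I1.
by rewrite I2; apply: eq_bigr => k _; have [_ ->] := fbm_kernel_moment k H01 t0.
Qed.

(** Tonelli on the triangle 0 < s < t <= T: the inner integral C t^p is integrable because p >
    -1. *)
Lemma integrable_triangle (T p C : R) (g : R * R -> R) : 0 < T -> -1 < p -> 0 <= C ->
  measurable_fun setT g -> (forall z, 0 <= g z) ->
  (forall z, ~~ (0 < z.2 < z.1) -> g z = 0) ->
  (forall t, 0 < t -> (\int[mu]_(s in `]0%R, t[) (g (t, s))%:E = (C * t `^ p)%:E)%E) ->
  (mu \x mu)%E.-integrable (`[0, T] `*` `[0, T]) (EFin \o g).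
Proof.
move=> T0 p1 C0 mg g0 gout gint.
apply: (@ge0_integrable R _ _ _ _ _ (C * (T `^ (p + 1) / (p + 1)))) => //.
(* On the support 0 < s < t of [g], membership in the square amounts to t <= T. *)
pose f (z : R * R) : \bar R := (if z.1 <= T then g z else 0)%:E.
have mf : measurable_fun setT f.
  by apply/measurable_EFinP; apply: measurable_fun_ifT => //; apply: measurable_fun_ler.
have f0 z : (0 <= f z)%E by rewrite lee_fin; case: ifP.
transitivity (\int[(mu \x mu)%E]_z f z)%E.
  rewrite integral_mkcond; apply: eq_integral => -[t s] _; rewrite patchE /f/=.
  case: ifPn => [|].
    by rewrite inE/= !in_itv/= => -[/andP[_ ->]].
  rewrite notin_setE/= !in_itv/= => nD; case: ifPn => // tT.
  rewrite gout//=; apply/negP => /andP[s0 st]; apply: nD.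
  by rewrite tT (ltW s0) (ltW (lt_trans s0 st)) (le_trans (ltW st) tT).
rewrite (@fubini_tonelli1 _ _ _ _ _ mu mu f mf f0).
transitivity (\int[mu]_(t in `]0%R, T]) (C%:E * (t `^ p)%:E))%E; last first.
  rewrite ge0_integralZl// ?integral_powR_oc//.
  - by apply/measurable_EFinP; exact: measurable_funTS.
  - by move=> t _; rewrite lee_fin powR_ge0.
rewrite [RHS]integral_itv_if; apply: eq_integral => t _; rewrite in_itv/= /fubini_F /f/=.
have [t0|t0] := ltP 0 t; last first.
  rewrite /= integral0_eq// => s _; case: ifP => // _; rewrite gout//=.
  by apply/negP => /andP[s0 /(lt_trans s0)]; rewrite ltNge t0.
case: (boolP (t <= T)) => tT /=; last by rewrite integral0_eq.
rewrite -EFinM -gint// [RHS]integral_itv_if; apply: eq_integral => s _.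
by rewrite in_itv/=; case: ifPn => // st; rewrite gout.
Qed.

Lemma integrable_fbm_kernel H T : 0 < H < 1 -> 0 < T ->
  (mu \x mu)%E.-integrable (`[0, T] `*` `[0, T])
    (EFin \o (fun z => fbm_kernel H z.1 z.2)).
Proof.
move=> H01 T0; pose h := H - 1 / 2; pose c := fbm_const H / Gamma (H + 1 / 2).
have h12 : -1 < h < 1 by rewrite /h; move/andP: H01 => [? ?]; apply/andP; split; lra.
have h1 : 0 < h + 1 by move/andP: h12 => [? ?]; lra.
have ih : (mu \x mu)%E.-integrable (`[0, T] `*` `[0, T])
    (EFin \o (fun z => kernel_head h z.1 z.2)).
  apply: (@integrable_triangle T (h + 1) (beta_coef h 0)) => //; first lra.
  - exact: beta_coef_ge0.
  - exact: measurable_kernel_head.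
  - by move=> z; exact: kernel_head_ge0.
  - by move=> z /negbTE zF; rewrite /kernel_head zF.
  - move=> t t0; have := integral_kernel_head 0 h12 t0; rewrite addr0 => <-.
    by apply: eq_integral => s _; rewrite expr0 mul1r.
have it : (mu \x mu)%E.-integrable (`[0, T] `*` `[0, T])
    (EFin \o (fun z => kernel_tail h z.1 z.2)).
  apply: (@integrable_triangle T (h + 1) (beta_coef h 0 / (h + 1))) => //; first lra.
  - by rewrite divr_ge0 ?beta_coef_ge0// ltW.
  - exact: measurable_kernel_tail.
  - by move=> z; exact: kernel_tail_ge0.
  - by move=> z /negbTE zF; rewrite /kernel_tail zF.
  - move=> t t0; have := integral_kernel_tail 0 h12 t0; rewrite addr0 => <-.
    by apply: eq_integral => s _; rewrite expr0 mul1r.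
have mD : measurable (`[0, T] `*` `[0, T] : set (measurableTypeR R * measurableTypeR R)).
  exact: measurableX.
have iD := integrableB mD ih (integrableZl mD h it).
apply: eq_integrable (integrableZl mD c iD) => // z _.
by rewrite /= fbm_kernelE.
Qed.

End FractionalMatrix.

(** * From the double integral to an iterated one *)

Section IteratedIntegral.
Context {R : realType}.
Local Notation mu := (@lebesgue_measure R).
Implicit Types (H h s t T : R) (i j k : nat).

Lemma fbm_kernel_out H t s : t <= s -> fbm_kernel H t s = 0.
Proof. by move=> ts; rewrite /fbm_kernel [s < t]ltNge ts andbF. Qed.

(** At t = 0 the kernel vanishes for s >= 0, and the right side consists of powers of 0 with
    positive exponents. The iterated integral over [0, T] evaluates the inner one there too. *)
Lemma fbm_kernel_legendre0 H T j t : 0 < H < 1 -> 0 <= t ->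
  mu.-integrable `[0, t] (EFin \o (fun s => fbm_kernel H t s * legendre T j s)) /\
  \int[mu]_(s in `[0, t]) (fbm_kernel H t s * legendre T j s) =
  \sum_(k < j.+1) legendre_norm T j * legendre_coef j k / T ^+ k *
    (moment_coef H k * t `^ (H + 1 / 2 + k%:R)).
Proof.
move=> H01; rewrite le_eqVlt => /predU1P[<-|]; last exact: fbm_kernel_legendre.
have k0 s : 0 <= s -> fbm_kernel H 0 s = 0 by move=> /fbm_kernel_out.
split.
  apply: (@eq_integrable _ _ _ _ _ _ (cst 0%E)) => //; last exact: integrable0.
  by move=> s; rewrite inE/= in_itv/= => /andP[s0 _]; rewrite k0// mul0r.
rewrite set_itv1 Rintegral_set1 big1// => k _.
rewrite powR0 ?mulr0// gt_eqF//; have : 0 <= k%:R :> R by [].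
by move/andP: H01 => [? ?] ?; lra.
Qed.

Lemma integrable_fbm_integrand H T i j : 0 < H < 1 -> 0 < T ->
  (mu \x mu)%E.-integrable (`[0, T] `*` `[0, T]) (EFin \o fbm_integrand T H i j).
Proof.
move=> H01 T0.
have [Ci Ci0 HCi] := legendre_bounded i T0; have [Cj Cj0 HCj] := legendre_bounded j T0.
have mD : measurable (`[0, T] `*` `[0, T] : set (measurableTypeR R * measurableTypeR R)).
  exact: measurableX.
apply: (@le_integrable _ _ R (mu \x mu)%E _ mD _
  (fun z => (Ci * Cj)%:E * (EFin \o (fun z => fbm_kernel H z.1 z.2)) z)%E).
- apply/measurable_EFinP; apply: measurable_funTS; apply: measurable_funM.
    apply: measurable_funM; first exact: (measurableT_comp (measurable_legendre T i)).
    exact: (measurableT_comp (measurable_legendre T j)).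
  exact: measurable_fbm_kernel.
- move=> [t s] /=; rewrite !in_itv/= => -[tT sT].
  rewrite lee_fin /fbm_integrand/= [leLHS]normrM [leRHS]normrM ler_wpM2r//.
  by rewrite [leLHS]normrM [leRHS]ger0_norm ?mulr_ge0// ler_pM ?HCi ?HCj.
- exact: (integrableZl mD _ (integrable_fbm_kernel H01 T0)).
Qed.

(** Fubini over the square; the inner domain shrinks from [0, T] to [0, t] because the kernel is
    zero beyond the diagonal. *)
Lemma fbm_matrix_iterated H T i j : 0 < H < 1 -> 0 < T ->
  fbm_matrix T H i j = \int[mu]_(t in `[0, T]) (legendre T i t *
    \int[mu]_(tau in `[0, t]) (fbm_kernel H t tau * legendre T j tau)).
Proof.
move=> H01 T0; rewrite /fbm_matrix /Rintegral; congr fine.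
have mD : measurable (`[0, T] `*` `[0, T] : set (measurableTypeR R * measurableTypeR R)).
  exact: measurableX.
have iD := integrable_fbm_integrand i j H01 T0.
have iT := (integrable_mkcond _ mD).1 iD.
rewrite integral_mkcond -(integral12_prod_meas1 iT).
rewrite [RHS]integral_itv_if; apply: eq_integral => t _; rewrite in_itv/= /fubini_F.
case: ifPn => [/andP[t0 tT]|tF]; last first.
  rewrite integral0_eq// => s _; rewrite patchE memNset//= !in_itv/= => -[].
  by rewrite (negbTE tF).
have [int _] := fbm_kernel_legendre0 T j H01 t0.
(* The inner real integral is a [fine]; its finiteness allows a return to the extended-real
   integral. *)
rewrite EFinM fineK; last exact: (integrable_fin_num _ int).
rewrite -integralZl//.
rewrite [RHS]integral_itv_if; apply: eq_integral => s _; rewrite in_itv/=.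
have [/andP[s0 st]|sF] := boolP (0 <= s <= t).
  rewrite patchE mem_set/= ?in_itv/= ?t0 ?tT ?s0 ?(le_trans st tT)//.
  by rewrite /fbm_integrand/= -EFinM; congr EFin; ring.
rewrite patchE; have [|//] := boolP ((t, s) \in `[0, T] `*` `[0, T]).
rewrite inE/= !in_itv/= => -[_ /andP[s0 sT]].
rewrite /fbm_integrand/= fbm_kernel_out ?mulr0// ltW// ltNge.
by move: sF; rewrite s0.
Qed.

Lemma integrable_powR_legendre T p i : 0 < T -> 0 <= p ->
  mu.-integrable `[0, T] (EFin \o (fun t => t `^ p * legendre T i t)).
Proof.
move=> T0 p0; have [C C0 HC] := legendre_bounded i T0.
apply: (@le_integrable _ (measurableTypeR R) R mu `[0, T]%classic _ _
  (EFin \o cst (T `^ p * C))) => //.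
- apply/measurable_EFinP; apply: measurable_funTS; apply: measurable_funM => //.
  exact: measurable_legendre.
- move=> t /=; rewrite in_itv/= => tT; have /andP[t0 tT'] := tT.
  rewrite lee_fin normrM [leRHS]ger0_norm ?mulr_ge0 ?powR_ge0//.
  rewrite ler_pM ?HC// ger0_norm ?powR_ge0// ge0_ler_powR ?nnegrE//.
  exact: (le_trans t0).
- apply/integrableP; split; first exact/measurable_EFinP.
  apply: (@le_lt_trans _ _ (\int[mu]_(x in `[0%R, T]) cst `|T `^ p * C|%:E x)%E) => //.
  rewrite integral_cst//= lebesgue_measure_itv/= lte_fin T0 -EFinB -EFinM.
  exact: ltry.
Qed.

Lemma fbm_matrixE H T i j : 0 < H < 1 -> 0 < T ->
  fbm_matrix T H i j = \sum_(k < j.+1)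
    legendre_norm T j * legendre_coef j k / T ^+ k * moment_coef H k *
    legendre_pow T (H + 1 / 2 + k%:R) i.
Proof.
move=> H01 T0; rewrite fbm_matrix_iterated//.
transitivity (\int[mu]_(t in `[0, T]) (\sum_(k < j.+1)
    legendre_norm T j * legendre_coef j k / T ^+ k * moment_coef H k *
    (t `^ (H + 1 / 2 + k%:R) * legendre T i t))).
  apply: eq_Rintegral => t; rewrite inE/= in_itv/= => /andP[t0 _].
  have [_ ->] := fbm_kernel_legendre0 T j H01 t0.
  by rewrite mulr_sumr; apply: eq_bigr => k _; ring.
have [|_ ->] := @Rintegral_lincomb R _ (measurableTypeR R) mu `[0, T]%classic j.+1
   (fun k => legendre_norm T j * legendre_coef j k / T ^+ k * moment_coef H k)
   (fun k t => t `^ (H + 1 / 2 + k%:R) * legendre T i t) (measurable_itv _) => //.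
move=> k; apply: integrable_powR_legendre => //.
by have : 0 <= k%:R :> R by []; move/andP: H01 => [? ?]; lra.
Qed.

End IteratedIntegral.

(** * Recurrences for the Legendre coefficients of powers *)

Section LegendreCoefficients.
Context {R : realType}.
Local Notation mu := (@lebesgue_measure R).
Implicit Types (H T a : R) (i j k : nat).

(** The product of (k+1) C(i+k+1, k+1) = (i+k+1) C(i+k, k) and (k+1) C(i, k+1) = (i-k) C(i, k). *)
Lemma legendre_binS i k : (k < i)%N ->
  (('C(i + k.+1, i) * 'C(i, i - k.+1)) * (k.+1 * k.+1) =
   ('C(i + k, i) * 'C(i, i - k)) * ((i - k) * (i + k).+1))%N.
Proof.
move=> ki; have E m : 'C(i + m, i) = 'C(i + m, m).
  by have := @bin_sub (i + m) m (leq_addl _ _); rewrite addnK.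
rewrite !E !bin_sub ?(ltnW ki)// addnS.
have H1 := mul_bin_diag (i + k).+1 k; have H2 := mul_bin_left i k.
by rewrite mulnACA ![(_ * k.+1)%N]mulnC -H1 H2 /=; lia.
Qed.

Lemma legendre_coefS i k : (k < i)%N ->
  legendre_coef i k.+1 * k.+1%:R ^+ 2 =
  - (i%:R - k%:R) * (i%:R + k%:R + 1) * legendre_coef i k :> R.
Proof.
move=> ki; rewrite /legendre_coef -!mulrA expr2 -!natrM mulrA.
rewrite [X in _ * X](_ : _ = 'C(i + k, i)%:R * 'C(i, i - k)%:R * ((i%:R - k%:R) * (i%:R + k%:R + 1))).
  rewrite (_ : (i - k)%N = (i - k.+1).+1) ?exprS; last by rewrite subnSK.
  ring.
rewrite -natrB ?(ltnW ki)// -natrD natr1 -!natrM; congr _%:R.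
by rewrite -legendre_binS// mulnA.
Qed.

(** For a > -1, the integral over [0, 1] of u^a against the unnormalized shifted Legendre
    polynomial. *)
Definition legendre_sum i a : R := \sum_(k < i.+1) legendre_coef i k / (a + k%:R + 1).

(* [a^2 + a - i(i+1) = (a+k+1)(a-k) + k(k+1) - i(i+1)] and [a^2 = (a+k)(a-k) + k^2];
   the remaining sums agree after shifting [k], by [legendre_coefS]. *)
Lemma legendre_sum_rec i a : 0 < a ->
  (a - i%:R) * (a + i%:R + 1) * legendre_sum i a = a ^+ 2 * legendre_sum i (a - 1).
Proof.
move=> a0.
have ak k : a + k%:R != 0 :> R by rewrite gt_eqF// ltr_wpDr.
have ak1 k : a + k%:R + 1 != 0 :> R by rewrite gt_eqF// ltr_wpDr// ltr_wpDr.
apply/eqP; rewrite -subr_eq0; apply/eqP.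
transitivity (\sum_(k < i.+1)
    legendre_coef i k * (k%:R * (k%:R + 1) - i%:R * (i%:R + 1)) / (a + k%:R + 1) -
  \sum_(k < i.+1) legendre_coef i k * k%:R ^+ 2 / (a + k%:R)).
  rewrite /legendre_sum !mulr_sumr -!sumrB; apply: eq_bigr => k _.
  have -> : a - 1 + k%:R + 1 = a + k%:R by ring.
  by field; rewrite ak ak1.
(* The term k = i of the first sum vanishes, and so does the term k = 0 of the second; the other
   indices pair up as k and k+1. *)
rewrite big_ord_recr/= subrr mulr0 mul0r addr0.
rewrite big_ord_recl/= expr0n/= mulr0 mul0r add0r -sumrB big1// => k _.
rewrite /bump/= add1n legendre_coefS// -natr1 addrA.
by field.
Qed.

Lemma legendre_powE T a i : 0 < T -> 0 < a ->
  legendre_pow T a i = legendre_norm T i * T `^ (a + 1) * legendre_sum i a.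
Proof.
move=> T0 a0; rewrite /legendre_pow.
transitivity (\int[mu]_(t in `[0, T]) (\sum_(k < i.+1)
    legendre_norm T i * legendre_coef i k / T ^+ k * (t `^ (a + k%:R)))).
  apply: eq_Rintegral => t; rewrite inE/= in_itv/= => /andP[t0 _].
  rewrite legendreE mulr_sumr; apply: eq_bigr => k _.
  rewrite mulrCA; congr (_ * _).
  move: t0; rewrite le_eqVlt => /predU1P[<-|t0].
    by rewrite !powR0 ?mul0r// gt_eqF// ltr_wpDr.
  by rewrite powRD_gt0// powR_mulrn// ltW.
have I k : (\int[mu]_(t in `[0%R, T]) (t `^ (a + k%:R))%:E =
    (T `^ (a + k%:R + 1) / (a + k%:R + 1))%:E)%E.
  rewrite integral_itv_bndoo ?integral_powR_oo//.
    by rewrite (lt_trans (ltrN10 R))// ltr_wpDr.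
  by apply/measurable_EFinP; exact: measurable_funTS.
have [|_ ->] := @Rintegral_lincomb R _ (measurableTypeR R) mu `[0, T]%classic i.+1
   (fun k => legendre_norm T i * legendre_coef i k / T ^+ k)
   (fun k t => t `^ (a + k%:R)) (measurable_itv _).
  move=> k; apply: (ge0_integrable _ _ (I k)) => // t; exact: powR_ge0.
rewrite /legendre_sum mulr_sumr; apply: eq_bigr => k _.
rewrite /Rintegral I/=.
have -> : T `^ (a + k%:R + 1) = T `^ (a + 1) * T ^+ k.
  by rewrite -powR_mulrn ?(ltW T0)// -powRD_gt0// addrAC.
have ak1 : a + k%:R + 1 != 0 :> R by rewrite gt_eqF// ltr_wpDr// ltr_wpDr.
by field; rewrite ak1 expf_neq0// gt_eqF.
Qed.

Lemma legendre_pow_rec T a i : 0 < T -> 1 < a -> a != i%:R ->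
  legendre_pow T a i =
  T * a ^+ 2 / ((a - i%:R) * (a + i%:R + 1)) * legendre_pow T (a - 1) i.
Proof.
move=> T0 a1 ai; have a0 : 0 < a by rewrite (lt_trans ltr01).
have a10 : 0 < a - 1 by rewrite subr_gt0.
have ai1 : a + i%:R + 1 != 0 by rewrite gt_eqF// ltr_wpDr// ltr_wpDr.
have ai0 : a - i%:R != 0 by rewrite subr_eq0.
rewrite !legendre_powE// subrK -(mulr_powRB1_gt0 (a + 1) T0) addrK.
have S := legendre_sum_rec i a0.
have -> : legendre_sum i a = a ^+ 2 * legendre_sum i (a - 1) / ((a - i%:R) * (a + i%:R + 1)).
  by rewrite -S mulrC mulKf// mulf_neq0.
by field; rewrite ai0 ai1.
Qed.

(** Both sides acquire the same rational factor from k to k+1, by [legendre_binS] and by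
    [legendre_pow_rec] at H+1/2+k+1. The factor 1/2 - H on the left compensates the passage from
    Gamma(3/2-H) to Gamma(1/2-H). *)
Lemma fbm_Pi_term T H i j k : 0 < T -> 0 < H < 1 -> H != 1 / 2 -> (k <= j)%N ->
  ('C(j + k, j) * 'C(j, j - k))%:R * ((1 / 2 - H) * rising (3 / 2 - H) k) /
    (T ^+ k * k`!%:R) * legendre_pow T (H + 1 / 2 + k%:R) i =
  legendre_pow T (H + 1 / 2) i * ((1 / 2 - H + k%:R) * fbm_Pi H i j k).
Proof.
move=> T0 /andP[H0 H1] Hn; elim: k => [|k IH] kj.
  by rewrite addn0 subn0 !binn muln1 rising0 expr0 fact0 /= !addr0; field.
have {IH} := IH (ltnW kj).
have k0 : 0 <= k%:R :> R by [].
have kS : k.+1%:R = k%:R + 1 :> R by rewrite natr1.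
(* H + 1/2 lies strictly between 1/2 and 3/2, so equality would force i = k + 2 and H = 1/2, the
   excluded value. *)
have HE : H + 1 / 2 + k.+1%:R != i%:R.
  apply/eqP; rewrite kS => E; move/eqP: Hn; apply.
  have [ik|] := leqP i k.+1.
    by have : i%:R <= k%:R + 1 :> R by [rewrite natr1 ler_nat]; lra.
  rewrite leq_eqVlt => /predU1P[Ei|ik].
    by move: E; rewrite -Ei -[k.+2]addn2 natrD; lra.
  have : k%:R + 3 <= i%:R :> R by rewrite -natrD addn3 ler_nat.
  lra.
rewrite (@legendre_pow_rec T (H + 1 / 2 + k.+1%:R))//; last by rewrite kS; lra.
rewrite (_ : H + 1 / 2 + k.+1%:R - 1 = H + 1 / 2 + k%:R); last by rewrite kS; ring.
set F := legendre_pow T (H + 1 / 2 + k%:R) i => IH.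
have B : ('C(j + k.+1, j) * 'C(j, j - k.+1))%:R =
    ('C(j + k, j) * 'C(j, j - k))%:R * ((j%:R - k%:R) * (j%:R + k%:R + 1)) / (k%:R + 1) ^+ 2 :> R.
  apply: (canRL (mulfK _)); first by rewrite expf_neq0// natr1 pnatr_eq0.
  rewrite natr1 -natrD natr1 -natrB ?(ltnW kj)// expr2 -!natrM; congr _%:R.
  exact: legendre_binS.
rewrite B {B} risingS /= factS [(k.+1 * _)%:R]natrM (exprS T).
move: ('C(j + k, j) * 'C(j, j - k))%:R IH => G IH.
have f0 : k`!%:R != 0 :> R by rewrite pnatr_eq0 -lt0n fact_gt0.
have Tk0 : T ^+ k != 0 by rewrite expf_neq0// gt_eqF.
set b := H + 1 / 2 in F HE IH *.
rewrite kS in HE *.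
set K : R := k%:R + 1 in HE *.
have K0 : K != 0 by rewrite /K natr1 pnatr_eq0.
have b0 : 0 < b by rewrite /b; lra.
have d1 : b - i%:R + K != 0 by rewrite addrAC subr_eq0.
have d2 : b + i%:R + K + 1 != 0.
  by rewrite gt_eqF// /K; have : 0 <= i%:R :> R by []; lra.
have d1' : b + K - i%:R != 0 by rewrite subr_eq0.
have d2' : b + K + i%:R + 1 != 0 by rewrite [_ + K + _]addrAC.
have T1 : T != 0 by rewrite gt_eqF.
transitivity (legendre_pow T (b) i * ((1 / 2 - H + k%:R) * fbm_Pi H i j k) *
  ((1 / 2 - H + K) * (b + K) ^+ 2 / K ^+ 3 * ((j%:R - k%:R) * (j%:R + K)) /
   ((b - i%:R + K) * (b + i%:R + K + 1)))); last first.
  (* The factor K - 1/2 - H in the recurrence of [fbm_Pi] is the weight 1/2 - H + k of the preceding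
     term, as it stands in the induction hypothesis. *)
  rewrite (_ : 1 / 2 - H + k%:R = K - 1 / 2 - H); last by rewrite /K; field.
  rewrite (_ : j%:R - K + 1 = j%:R - k%:R); last by rewrite /K; ring.
  by field; rewrite K0 d1 d2.
rewrite -IH (_ : 3 / 2 - H + k%:R = 1 / 2 - H + K); last by rewrite /K; field.
rewrite (_ : j%:R + k%:R + 1 = j%:R + K); last by rewrite /K; ring.
rewrite (_ : b + K - i%:R = b - i%:R + K); last by ring.
rewrite (_ : b + K + i%:R + 1 = b + i%:R + K + 1); last by ring.
move: (k`!%:R : R) (T ^+ k) f0 Tk0 => f Tk f0 Tk0.
by field; rewrite K0 d1 d2 f0 Tk0 T1.
Qed.

End LegendreCoefficients.

(** * The two formulas for the matrix of the kernel *)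

Unset Implicit Arguments.

Theorem theorem1 (R : realType) (T H : R) (T_gt0 : 0 < T) (H01 : 0 < H < 1) :
  (forall i j : nat,
     (lebesgue_measure \x lebesgue_measure)%E.-integrable
       (`[0, T] `*` `[0, T]) (EFin \o fbm_integrand T H i j) /\
     fbm_matrix T H i j =
       \int[lebesgue_measure]_(t in `[0, T])
         (legendre T i t *
          \int[lebesgue_measure]_(tau in `[0, t])
            (fbm_kernel H t tau * legendre T j tau))) /\
  (forall j : nat,
     (fun i : nat => fbm_matrix T H i j) =
     (fun i : nat =>
        fbm_const H * Gamma (3 / 2 - H) * Num.sqrt ((2 * j%:R + 1) / T) *
        \sum_(k < j.+1)
          legendre_coef j k * rising (3 / 2 - H) k /
          (T ^+ k * (H + 1 / 2 + k%:R) * k`!%:R) *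
          legendre_pow T (H + 1 / 2 + k%:R) i)) /\
  (H != 1 / 2 ->
   forall i j : nat,
     fbm_matrix T H i j =
     fbm_const H * Gamma (1 / 2 - H) * Num.sqrt ((2 * j%:R + 1) / T) *
     legendre_pow T (H + 1 / 2) i *
     \sum_(k < j.+1)
       (-1) ^+ (j - k) * ((1 / 2 - H + k%:R) / (H + 1 / 2 + k%:R)) *
       fbm_Pi H i j k).
Proof.
have nz k : (T ^+ k != 0) && ((H + 1 / 2 + k%:R != 0) && (k`!%:R != 0 :> R)).
  apply/and3P; split.
  - by rewrite expf_neq0// gt_eqF.
  - by rewrite gt_eqF//; have : 0 <= k%:R :> R by []; move/andP: H01 => [? ?]; lra.
  - by rewrite pnatr_eq0 -lt0n fact_gt0.
split=> [i j|].
  by split; [exact: integrable_fbm_integrand|exact: fbm_matrix_iterated].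
split=> [j|Hn i j].
  apply/funext => i; rewrite fbm_matrixE// mulr_sumr; apply: eq_bigr => k _.
  have /and3P[Tk bk fk] := nz k.
  rewrite /moment_coef -/(legendre_norm T j).
  move: (H + 1 / 2 + k%:R) bk => b bk; move: (k`!%:R : R) fk => f fk.
  by field; rewrite Tk bk fk.
have H12 : 1 / 2 - H != 0 by rewrite subr_eq0 eq_sym.
(* The argument 1/2 - H lies in ]-1/2, 1/2[ and is nonzero, within the range of [GammaS]. *)
have -> : Gamma (1 / 2 - H) = Gamma (3 / 2 - H) / (1 / 2 - H).
  rewrite (_ : 3 / 2 - H = 1 / 2 - H + 1); last by field.
  by rewrite GammaS// ?[_ * Gamma _]mulrC ?mulfK//; move/andP: H01 => [? ?]; lra.
rewrite fbm_matrixE// mulr_sumr; apply: eq_bigr => k _.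
have /and3P[Tk bk fk] := nz k.
have P := fbm_Pi_term i T_gt0 H01 Hn (ltn_ord k : (k <= j)%N).
(* Regroups the summand so that the right side of [fbm_Pi_term] stands as one factor. *)
transitivity (fbm_const H * Gamma (3 / 2 - H) / (1 / 2 - H) * legendre_norm T j *
  ((-1) ^+ (j - k) / (H + 1 / 2 + k%:R)) *
  (legendre_pow T (H + 1 / 2) i * ((1 / 2 - H + k%:R) * fbm_Pi H i j k))); last first.
  rewrite -/(legendre_norm T j); move: (H + 1 / 2 + k%:R) bk => b bk.
  move: (1 / 2 - H) H12 => c H12; by field; rewrite bk H12.
rewrite -P /moment_coef /legendre_coef natrM.
move: (H + 1 / 2 + k%:R) bk => b bk; move: (k`!%:R : R) fk => f fk.
move: (1 / 2 - H) H12 => c H12.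
by field; rewrite Tk bk fk H12.
Qed.
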